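(* Let $J,\nu\in\mathbb N$ and $a>0$ satisfy $$a\Big(1+\frac1\nu\Big)<1,\qquad 1<\nu<J,\qquad \frac{J}{2J-\nu}<a<1-\frac{(J+\nu)(J+\nu^2)}{\nu(J^2+J+\nu^2)} .$$ Consider the single class multihop switched network with parameters $(a,\nu,J)$ described in the context, operated under the MaxWeight policy. Then its traffic intensity vector $\boldsymbol\rho$ lies in the subcritical region $\mathcal C$ (the interior of the convex hull of the set $\mathcal S$ of feasible schedules), and the associated queueing network process $(\mathbf Q(t):t\in\mathbb Z_+)$ is transient.
   Context: $\mathbb Z_+=\{0,1,2,\dots\}$, $\mathbb N=\{1,2,\dots\}$. **The network.** There are $2J+2$ queues $\mathcal A_0,\mathcal A_1,\dots,\mathcal A_J,\mathcal B_0,\mathcal B_1,\dots,\mathcal B_J$. Time is discrete. External arrivals occur only at the queues $\mathcal A_j,\mathcal B_j$ with $1\le j\le J$. At each such queue the number of external arrivals per time unit is $0$ or $1$ with mean $a/J$, i.i.d. over time and independent across queues. Every job requires exactly one unit of service at each queue it visits. A job completing service at $\mathcal A_j$ ($1\le j\le J$) moves to $\mathcal B_0$. A job completing service at $\mathcal B_j$ ($1\le j\le J$) moves to $\mathcal A_0$. Jobs completing service at $\mathcal A_0$ or $\mathcal B_0$ leave the network. **Traffic intensity.** $\rho_{\mathcal A_0}=\rho_{\mathcal B_0}=a$ and $\rho_{\mathcal A_j}=\rho_{\mathcal B_j}=a/J$ for $1\le j\le J$. **Schedules.** $\mathcal S$ is the set of vectors $\boldsymbol\sigma$ with coordinates in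 $\mathbb Z_+$, indexed by the queues, satisfying $$\sigma_{\mathcal A_0}+\frac1\nu\sum_{j=1}^J\sigma_{\mathcal A_j}\le 1\quad\text{and}\quad \sigma_{\mathcal B_0}+\frac1\nu\sum_{j=1}^J\sigma_{\mathcal B_j}\le 1 .$$ **MaxWeight policy.** Given the queue length vector $\mathbf Q$, it chooses a schedule $\boldsymbol\pi(\mathbf Q)\in\mathcal S$ maximizing $\sum_i Q_i\sigma_i$ over $\boldsymbol\sigma\in\mathcal S$ (sum over all queues $i$). Ties are broken arbitrarily or randomly, depending only on $\mathbf Q$. **Dynamics.** In time step $t\in\mathbb N$, queue $i$ first serves $\pi_i(\mathbf Q(t-1))\wedge Q_i(t-1)$ jobs. Then the served jobs move to their next queue or leave, and the external arrivals of step $t$ join their queues. The resulting queue length vector is $\mathbf Q(t)$. The process $(\mathbf Q(t))$ is a discrete time Markov chain on a countable state space. *)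

(* Defs.v *)
From mathcomp Require Import all_boot all_order all_algebra.
From mathcomp Require Import all_classical all_reals all_analysis.
Set Implicit Arguments.
Unset Strict Implicit.
Unset Printing Implicit Defensive.
Import Order.TTheory GRing.Theory Num.Theory.
Import numFieldNormedType.Exports.
Local Open Scope classical_set_scope.
Local Open Scope ring_scope.

(* The Boolean selects the family: false for A, true for B.
   (c, None) is A_0 or B_0; (c, Some j) is A_(j+1) or B_(j+1), j < J. *)
Notation queue J := (bool * option 'I_J)%type.

(* (c, j) stands for the external arrivals at the queue (c, Some j). *)
Notation source J := (bool * 'I_J)%type.

(* Used both for queue length vectors and for schedules. *)
Notation qvec J := {ffun queue J -> nat}.

Definition schedules (R : realType) (J nu : nat) : set (qvec J) :=
  [set s : qvec J | forall c : bool,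
    (s (c, None))%:R + nu%:R^-1 * \sum_(j < J) (s (c, Some j))%:R <= 1 :> R].

Definition traffic (R : realType) (J : nat) (a : R) (i : queue J) : R :=
  if i.2 is Some _ then a / J%:R else a.

(* R^(queue J) is represented by row vectors, through the enumeration of the
   2J+2 queues, to use the topology of finite-dimensional spaces. *)
Definition qrow (R : realType) (J : nat) (f : queue J -> R) :
    'rV[R]_#|{: queue J}| :=
  \row_k f (enum_val k).

Definition convex_hull (R : realType) (V : lmodType R) (A : set V) : set V :=
  smallest (@convex_set R V) A.

Definition subcritical (R : realType) (J nu : nat) :
    set 'rV[R]_#|{: queue J}| :=
  (convex_hull [set qrow (fun i => (s i)%:R) | s in @schedules R J nu])°.

Definition weight (J : nat) (q s : qvec J) : nat :=
  (\sum_(i : queue J) q i * s i)%N.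

(* A randomized policy: when the queue lengths are q and the auxiliary random
   seed takes the value u, the schedule pol q u is used.  A deterministic
   tie-breaking rule is a policy that ignores u. *)
Definition maxweight (R : realType) (J nu : nat) (d : measure_display)
    (U : measurableType d) (pol : qvec J -> U -> qvec J) : Prop :=
  forall q : qvec J,
    (forall s : qvec J, measurable [set u | pol q u = s]) /\
    forall u : U, schedules R nu (pol q u) /\
      forall s : qvec J, schedules R nu s -> (weight q s <= weight q (pol q u))%N.

Definition served (J : nat) (q s : qvec J) (i : queue J) : nat :=
  minn (s i) (q i).

Definition step (J : nat) (q s : qvec J) (e : source J -> nat) : qvec J :=
  [ffun i : queue J => (q i - served q s i +
    match i.2 with
    | None => \sum_(j < J) served q s (~~ i.1, Some j)
    | Some j => e (i.1, j)
    end)%N].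

(* The process started at x; time step t.+1 uses the seed xi t and the
   arrivals arr t. *)
Fixpoint queue_process (J : nat) (Omega U : Type) (pol : qvec J -> U -> qvec J)
    (xi : nat -> Omega -> U) (arr : nat -> source J -> Omega -> bool)
    (x : qvec J) (t : nat) (w : Omega) : qvec J :=
  match t with
  | 0%N => x
  | t'.+1 =>
      let q := queue_process pol xi arr x t' w in
      step q (pol q (xi t' w)) (fun i => arr t' i w : nat)
  end.

Definition mutually_independent (R : realType) (d : measure_display)
    (Omega : measurableType d) (P : probability Omega R) (I : eqType)
    (F : I -> set (set Omega)) : Prop :=
  forall (s : seq I) (E : I -> set Omega), uniq s ->
    (forall i, i \in s -> F i (E i)) ->
    (P (\bigcap_(i in [set` s]) E i) = \prod_(i <- s) P (E i))%E.

Definition noise_events (J : nat) (d d' : measure_display)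
    (Omega : measurableType d) (U : measurableType d')
    (xi : nat -> {mfun Omega >-> U})
    (arr : nat -> source J -> {mfun Omega >-> bool})
    (k : nat + nat * source J) : set (set Omega) :=
  match k with
  | inl t => preimage_set_system setT (xi t) measurable
  | inr (t, i) => preimage_set_system setT (arr t i) measurable
  end.

Definition network_noise (R : realType) (J : nat) (a : R)
    (d d' : measure_display) (Omega : measurableType d) (U : measurableType d')
    (P : probability Omega R) (xi : nat -> {mfun Omega >-> U})
    (arr : nat -> source J -> {mfun Omega >-> bool}) : Prop :=
  [/\ mutually_independent P (noise_events xi arr),
      forall t i, ('E_P[(fun w => (arr t i w)%:R : R)] = (a / J%:R)%:E)%E &
      forall t (B : set U), measurable B ->
        distribution P (xi t) B = distribution P (xi 0%N) B].

(* X x is a version of the Markov chain started at x; the chain is transient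
   if, from every state x, the probability of ever returning to x is < 1. *)
Definition transient (R : realType) (d : measure_display)
    (Omega : measurableType d) (P : probability Omega R) (S : Type)
    (X : S -> nat -> Omega -> S) : Prop :=
  forall x : S,
    (P [set w | exists2 t : nat, (0 < t)%N & X x t w = x] < 1)%E.

(* Main.v *)
(* Suppose side c holds all the jobs, with Q_{c,0} about nu times each Q_{c,j},
   and S jobs in the queues Q_{c,j}.  MaxWeight then keeps Q_{c,0} and
   nu max_j Q_{c,j} balanced while side c drains, in bursts of nu jobs which
   make the other hub Q_{c',0} grow; while this hub exceeds nu max_j Q_{c',j}
   the queues Q_{c',j} are not served and nothing feeds side c.  The bound h4 is
   what makes Q_{c',0} outgrow nu max_j Q_{c',j}, even if side c were fed at full
   rate.  After a time T with (1 - a + nu a / J) T = S, the hub has come down to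
   nu max_j Q_{c',j}, and the roles are exchanged with a T jobs in place of S;
   h3 says that a T > S.  The oscillation therefore grows geometrically, provided
   that the arrivals up to time t deviate from their mean by at most a small
   multiple of t.  By a Chernoff bound this has positive probability,
   independently of an initial stretch of m steps in which only side A receives
   arrivals, one at each queue; during that stretch the total number of jobs
   increases strictly, afterwards it stays above its initial value. *)
Require Import Defs.
From mathcomp Require Import all_boot all_order all_algebra.
From mathcomp Require Import all_classical all_reals all_analysis.
From mathcomp Require Import zify ring lra.
Set Implicit Arguments.
Unset Strict Implicit.
Unset Printing Implicit Defensive.
Import Order.TTheory GRing.Theory Num.Theory.
Import numFieldNormedType.Exports.
Local Open Scope classical_set_scope.
Local Open Scope ring_scope.

(** * Sample paths of a two-sided MaxWeight network *)

Section Path.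
Variables (R : realType) (J : nat) (v : R).

(* z c: length of the hub (c, None); x c j: length of the queue (c, Some j);
   r and g: jobs served there; e: external arrivals.  If side c holds more than
   v^2 + J v jobs, no service is wasted. *)
Record path_spec (z r : bool -> nat -> R) (x g e : bool -> 'I_J -> nat -> R) : Prop := {
  z_ge0 : forall c t, 0 <= z c t;
  x_ge0 : forall c j t, 0 <= x c j t;
  g_ge0 : forall c j t, 0 <= g c j t;
  e_ge0 : forall c j t, 0 <= e c j t;
  e_le1 : forall c j t, e c j t <= 1;
  zS : forall c t, z c t.+1 = z c t - r c t + \sum_j g (~~ c) j t;
  xS : forall c j t, x c j t.+1 = x c j t - g c j t + e c j t;
  r01 : forall c t, r c t = 0 \/ r c t = 1;
  sum_g_le : forall c t, \sum_j g c j t <= v;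
  r1_g0 : forall c t, r c t = 1 -> forall j, g c j t = 0;
  hub_first : forall c t, (forall j, v * x c j t < z c t) -> r c t = 1;
  g_longest : forall c j t, 0 < g c j t -> forall i, x c i t <= x c j t;
  r1_hub : forall c t, r c t = 1 -> forall j, v * x c j t <= z c t;
  nonidling : forall c t, 0 < z c t + \sum_j x c j t -> 1 <= r c t + \sum_j g c j t;
  full_service : forall c t, v ^+ 2 + J%:R * v < z c t + \sum_j x c j t ->
    v * r c t + \sum_j g c j t = v }.

Variables (z r : bool -> nat -> R) (x g e : bool -> 'I_J -> nat -> R).
Hypothesis H : path_spec z r x g e.

Definition psum (f : nat -> R) (t : nat) : R := \sum_(u < t) f u.

Lemma psum0 f : psum f 0 = 0. Proof. exact: big_ord0. Qed.
Lemma psumS f t : psum f t.+1 = psum f t + f t. Proof. exact: big_ord_recr. Qed.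

Lemma z_psum c t : z c t = z c 0 - psum (r c) t + psum (fun u => \sum_j g (~~ c) j u) t.
Proof.
elim: t => [|t IH]; first by rewrite !psum0 subr0 addr0.
by rewrite (zS H) IH !psumS; lra.
Qed.

Lemma x_psum c j t : x c j t = x c j 0 - psum (g c j) t + psum (e c j) t.
Proof.
elim: t => [|t IH]; first by rewrite !psum0 subr0 addr0.
by rewrite (xS H) IH !psumS; lra.
Qed.

Lemma sum_xS c t : \sum_j x c j t.+1 = \sum_j x c j t - \sum_j g c j t + \sum_j e c j t.
Proof. by rewrite -sumrB -big_split; apply: eq_bigr => j _; rewrite (xS H). Qed.

Lemma sum_x_psum c t :
  \sum_j x c j t = \sum_j x c j 0 - psum (fun u => \sum_j g c j u) t + \sum_j psum (e c j) t.
Proof.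
rewrite /psum [X in _ - X]exchange_big -sumrB -big_split; apply: eq_bigr => j _.
exact: x_psum.
Qed.

Lemma r_ge0 c t : 0 <= r c t.
Proof. by case: (r01 H c t) => ->. Qed.

Lemma r_le1 c t : r c t <= 1.
Proof. by case: (r01 H c t) => ->. Qed.

Lemma psum_r_le c t : psum (r c) t <= t%:R.
Proof.
elim: t => [|t IH]; first by rewrite psum0.
by rewrite psumS -natr1; have := r_le1 c t; lra.
Qed.

Lemma sum_x_ge0 c t : 0 <= \sum_j x c j t.
Proof. by apply: sumr_ge0 => j _; exact: (x_ge0 H). Qed.

Lemma sum_g_ge0 c t : 0 <= \sum_j g c j t.
Proof. by apply: sumr_ge0 => j _; exact: (g_ge0 H). Qed.

Lemma sum_e_le c t : \sum_j e c j t <= J%:R.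
Proof.
apply: (@le_trans _ _ (\sum_(j < J) 1)); first by apply: ler_sum => j _; exact: (e_le1 H).
by rewrite sumr_const card_ord.
Qed.

Lemma psum_g_ge0 c j t : 0 <= psum (g c j) t.
Proof. by apply: sumr_ge0 => u _; exact: (g_ge0 H). Qed.

Lemma psum_g_le_sum c j t : psum (g c j) t <= psum (fun u => \sum_i g c i u) t.
Proof.
apply: ler_sum => u _; rewrite (bigD1 j) //= lerDl.
by apply: sumr_ge0 => i _; exact: (g_ge0 H).
Qed.

Lemma x_le_sum c j t : x c j t <= \sum_i x c i t.
Proof.
rewrite (bigD1 j) //= lerDl.
by apply: sumr_ge0 => i _; exact: (x_ge0 H).
Qed.

(* u is the last time before t at which the queue j was served: it was then a
   longest queue. *)
Lemma x_balanced c t i j : 0 <= v -> exists2 u, (u <= t)%N &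
  x c i t - x c j t <= \sum_k x c k 0 + v
    + (psum (e c i) t - psum (e c i) u) - (psum (e c j) t - psum (e c j) u).
Proof.
move=> v0; elim: t => [|t [u ut IH]].
  exists 0%N => //; have := x_le_sum c i 0; have := x_ge0 H c j 0; lra.
have gi := g_ge0 H c i t; have [gj|gj] := ltP 0 (g c j t).
  exists t => //; rewrite !psumS !(xS H).
  have := g_longest H gj i; have := sum_x_ge0 c 0.
  have := sum_g_le H c t; rewrite (bigD1 j) //=.
  have : 0 <= \sum_(k < J | k != j) g c k t by apply: sumr_ge0 => k _; exact: (g_ge0 H).
  lra.
exists u; first exact: leqW.
by have := g_ge0 H c j t; rewrite !psumS !(xS H); lra.
Qed.
End Path.

(** * Half a period of the oscillation *)

Section Cycle.
Variables (R : realType) (J : nat) (n v a p : R).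
Hypotheses (nE : n = J%:R) (v_gt1 : 1 < v) (v_lt : v < n).
Hypotheses (a_gt0 : 0 < a) (a_lt1 : a < 1) (npE : n * p = a).

(** [small_bound] is the threshold of [full_service]. The other constants are multiplied by the
    noise level [h] and collect errors: [empty_const] those of [stays_drained], [hub_const] those of
    [next_hub], [serve_const] those of [hub_served_le]. *)
Definition small_bound : R := v ^+ 2 + n * v.
Definition empty_const : R := small_bound + 2 * n.
Definition hub_const : R := v * n * (empty_const + v + 4).
Definition serve_const : R := n * (empty_const + n) + v * n + hub_const + n + v ^+ 2.
(** This is [n + v ^+ 2] times the slope in [t] of the lower bound that [hub_dominates] gives for
    [z o t - v * x o j t]; [time_const * h] is the time this drift needs to overcome the errors. *)
Definition drift_gap : R := (1 - a) * (v * n - v ^+ 2) - n - (n + v ^+ 2) * v * p.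
Hypothesis drift_gap_gt0 : 0 < drift_gap.
Definition time_const : R := (v * serve_const + (n + v ^+ 2) * v * (empty_const + 1)) / drift_gap.

Variables (z r : bool -> nat -> R) (x g e : bool -> 'I_J -> nat -> R).
Hypothesis H : path_spec v z r x g e.
(** Side [c] is the loaded one. The hypotheses [hub0] and [empty0] are the invariants of the
    oscillation: [next_hub] and [stays_drained] restore them at the end of the half period with the
    sides exchanged. *)
Variables (c : bool) (h tmax : R).
Hypothesis h_ge1 : 1 <= h.
Hypothesis noise : forall b j t, t%:R <= tmax -> `|psum (e b j) t - p * t%:R| <= h.
Let o := ~~ c.
Hypothesis hub0 : n * z c 0 <= v * \sum_j x c j 0 + hub_const * h.
Hypothesis empty0 : \sum_j x o j 0 <= empty_const * h.

Let X b t := \sum_j x b j t.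
Let D b t := psum (fun u => \sum_j g b j u) t.
Let N b t := \sum_j psum (e b j) t.
Let W t := z c t + X c t.

Lemma noise_le b j t : t%:R <= tmax -> psum (e b j) t <= p * t%:R + h.
Proof. by move=> /(noise b j); rewrite ler_norml => /andP[_]; lra. Qed.

Lemma noise_ge b j t : t%:R <= tmax -> p * t%:R - h <= psum (e b j) t.
Proof. by move=> /(noise b j); rewrite ler_norml => /andP[+ _]; lra. Qed.

Lemma sum_noise_le b t : t%:R <= tmax -> N b t <= a * t%:R + n * h.
Proof.
move=> tH; apply: (@le_trans _ _ (\sum_(j < J) (p * t%:R + h))).
  by apply: ler_sum => j _; exact: noise_le.
by rewrite sumr_const card_ord -[_ *+ J]mulr_natl -nE mulrDr mulrA npE.
Qed.

Lemma sum_noise_ge b t : t%:R <= tmax -> a * t%:R - n * h <= N b t.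
Proof.
move=> tH; apply: (@le_trans _ _ (\sum_(j < J) (p * t%:R - h))); last first.
  by apply: ler_sum => j _; exact: noise_ge.
by rewrite sumr_const card_ord -[_ *+ J]mulr_natl -nE mulrBr mulrA npE.
Qed.

Let n_gt1 : 1 < n. Proof. exact: lt_trans v_lt. Qed.

Local Ltac params :=
  move: (v_gt1) (v_lt) (a_gt0) (a_lt1) (npE) (h_ge1) (n_gt1) => ? ? ? ? ? ? ?.

Let nv_gt0 : 0 < n * v. Proof. by params; apply: mulr_gt0; lra. Qed.
Let vv_gt0 : 0 < v ^+ 2. Proof. by params; apply: exprn_gt0; lra. Qed.
Let p_gt0 : 0 < p.
Proof. by params; have n0 : 0 < n by [lra]; rewrite -(pmulr_rgt0 _ n0) npE. Qed.
Let empty_const_gt0 : 0 < empty_const.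
Proof. by params; move: nv_gt0 vv_gt0; rewrite /empty_const /small_bound; lra. Qed.
Let hub_const_gt0 : 0 < hub_const.
Proof.
by params; move: empty_const_gt0 => ?; rewrite /hub_const mulr_gt0 // ?(mulrC v) //; lra.
Qed.

Local Ltac consts :=
  params; move: (nv_gt0) (vv_gt0) (p_gt0) (empty_const_gt0) (hub_const_gt0) => ? ? ? ? ?.

Lemma X_psum b t : X b t = X b 0 - D b t + N b t.
Proof. exact: (sum_x_psum H). Qed.

Lemma served_o_le t : t%:R <= tmax -> D o t <= empty_const * h + a * t%:R + n * h.
Proof.
move=> tH; consts; have := sum_noise_le o tH; have := sum_x_ge0 H o t.
by rewrite -/(X o t) X_psum; have := empty0; rewrite -/(X o 0); lra.
Qed.

Lemma full_psum t : (forall u, (u < t)%N -> small_bound < W u) ->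
  v * psum (r c) t + D c t = v * t%:R.
Proof.
consts.
elim: t => [|t IH] big; first by rewrite /D !psum0; lra.
have := big t (leqnn _); rewrite /small_bound nE => /(full_service H).
have := IH (fun u ut => big u (ltnW ut)).
by rewrite /D !psumS -natr1; lra.
Qed.

(* At the last service of the hub before t, the hub was at least v times as long
   as the average queue of its side. *)
Lemma hub_served_le t : (forall u, (u < t)%N -> small_bound < W u) -> t%:R <= tmax ->
  (n + v ^+ 2) * psum (r c) t <= (n * a + v ^+ 2 - v * a) * t%:R + serve_const * h.
Proof.
consts.
have vva : v * a <= v ^+ 2 by rewrite expr2 ler_pM2l; lra.
have na0 : 0 < n * a by apply: mulr_gt0; lra.
elim: t => [|t IH] big tH.
  rewrite psum0 !mulr0 add0r mulr_ge0 //; last by lra.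
  rewrite /serve_const; have : 0 < n * (empty_const + n) by apply: mulr_gt0; lra.
  lra.
have tH' : t%:R <= tmax by apply: le_trans tH; rewrite ler_nat.
have big' u : (u < t)%N -> small_bound < W u by move=> ut; exact/big/ltnW.
have coef : 0 <= n * a + v ^+ 2 - v * a by lra.
rewrite psumS -natr1.
case: (r01 H c t) => rt; first by have := IH big' tH'; rewrite rt; lra.
have hub : v * X c t <= n * z c t.
  rewrite /X mulr_sumr; apply: (@le_trans _ _ (\sum_(j < J) z c t)).
    by apply: ler_sum => j _; exact: (r1_hub H rt).
  by rewrite sumr_const card_ord -[_ *+ J]mulr_natl -nE.
have := full_psum big'; have := served_o_le tH'; have := sum_noise_ge c tH'.
(* Inserting the balance equations of both queue types turns [hub] into a linear inequality for
   [psum (r c) t], since full service expresses [D c t] through it. *)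
rewrite X_psum (z_psum H) -/o -/(D o t) in hub.
move=> Nc Do full; have Dc : D c t = v * t%:R - v * psum (r c) t by lra.
rewrite Dc in hub.
have Do' : n * D o t <= n * (empty_const * h + a * t%:R + n * h) by rewrite ler_pM2l //; lra.
have Nc' : v * (a * t%:R - n * h) <= v * N c t by rewrite ler_pM2l //; lra.
have h0 := hub0; rewrite -/(X c 0) in h0.
have nh : n + v ^+ 2 <= (n + v ^+ 2) * h by rewrite ler_peMr //; lra.
have Do'' : n * D o t <= n * (empty_const + n) * h + n * a * t%:R by nra.
rewrite rt /serve_const.
lra.
Qed.


Lemma x_psum_le b j t : t%:R <= tmax -> x b j t <= x b j 0 + p * t%:R + h.
Proof.
move=> tH; have := noise_le b j tH; have := psum_g_ge0 H b j t.
by rewrite (x_psum H); lra.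
Qed.

Lemma x_psum_ge b j t : t%:R <= tmax -> p * t%:R - h - D b t <= x b j t.
Proof.
move=> tH; have := noise_ge b j tH; have := psum_g_le_sum H b j t.
by rewrite -/(D b t) (x_psum H); have := x_ge0 H b j 0; lra.
Qed.

Lemma x_o_le j t : t%:R <= tmax -> x o j t <= (empty_const + 1) * h + p * t%:R.
Proof.
by move=> tH; have := x_psum_le o j tH; have := x_le_sum H o j 0; have := empty0; lra.
Qed.

(** The hub of side [o] receives [D c t = v * t - v * psum (r c) t] and serves at most [t] jobs,
    while each [x o j] grows at rate at most [p]. By [hub_served_le] the difference has slope at
    least [drift_gap / (n + v ^+ 2)]. *)
Lemma hub_dominates t : (forall u, (u < t)%N -> small_bound < W u) -> t%:R <= tmax ->
  time_const * h < t%:R -> forall j, v * x o j t < z o t.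
Proof.
consts; move=> big tH tC j.
have xj := x_o_le j tH; have full := full_psum big; have Rc := hub_served_le big tH.
have Ro := psum_r_le H o t; have zo := z_ge0 H o 0.
have zoE := z_psum H o t; rewrite negbK -/(D c t) in zoE.
have b0 := drift_gap_gt0.
have tC' : (v * serve_const + (n + v ^+ 2) * v * (empty_const + 1)) * h < drift_gap * t%:R.
  have -> : v * serve_const + (n + v ^+ 2) * v * (empty_const + 1) = drift_gap * time_const.
    by rewrite /time_const [RHS]mulrC divfK // gt_eqF.
  by rewrite -mulrA ltr_pM2l.
have nv2 : 0 < n + v ^+ 2 by lra.
rewrite -(ltr_pM2l nv2) zoE.
have Rc' : v * ((n + v ^+ 2) * psum (r c) t) <=
    v * ((n * a + v ^+ 2 - v * a) * t%:R + serve_const * h) by rewrite ler_pM2l //; lra.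
have xj' : (n + v ^+ 2) * (v * x o j t) <=
    (n + v ^+ 2) * (v * ((empty_const + 1) * h + p * t%:R)).
  by rewrite ler_pM2l // ler_pM2l //; lra.
have rest : (n + v ^+ 2) * (v * t%:R - t%:R - v * psum (r c) t) <=
    (n + v ^+ 2) * (z o 0 - psum (r o) t + D c t) by rewrite ler_pM2l //; lra.
by apply: le_lt_trans xj' _; apply: lt_le_trans rest; rewrite /drift_gap in tC'; lra.
Qed.

(** [S] is the stock that side [c] has to drain. [t1] is a waiting time long enough for
    [hub_dominates], and [T] ends an interval on which the other hub keeps priority. *)
Variable S : R.
Hypothesis SE : X c 0 = S.
Hypothesis hub_o0 : z o 0 <= (v + 1) * S.
Variables (t1 T : nat).
Hypotheses (t1_gt : time_const * h < t1%:R) (t1_le : t1%:R <= (time_const + 1) * h).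
Hypotheses (t1T : (t1 <= T)%N) (T_le : T%:R <= tmax).
Hypothesis dom : forall u, (t1 <= u < T)%N -> forall j, v * x o j u < z o u.

Let le_tmax t : (t <= T)%N -> t%:R <= tmax.
Proof. by move=> tT; apply: le_trans T_le; rewrite ler_nat. Qed.

Lemma served_o_late u : (t1 <= u < T)%N -> \sum_j g o j u = 0.
Proof. by move=> /dom /(hub_first H) /(r1_g0 H) g0; rewrite big1. Qed.

(** From [t1] on the hub has priority and the queues [x o j] get no service, so only the first [t1]
    steps count, with at most [v] jobs each. *)
Lemma served_o_early t : (t <= T)%N -> D o t <= v * t1%:R.
Proof.
consts; elim: t => [|t IH] tT; first by rewrite /D psum0 mulr_ge0 // ?ler0n //; lra.
rewrite /D psumS -/(D o t); have [t1t|tt1] := leqP t1 t.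
  by rewrite served_o_late ?t1t // addr0; apply/IH/ltnW.
have le_t u : (u <= t.+1)%N -> D o u <= v * u%:R.
  elim: u => [|u IHu] ut; first by rewrite /D psum0 mulr0.
  rewrite /D psumS -/(D o u) -natr1; have := IHu (ltnW ut); have := sum_g_le H o u; lra.
have := le_t _ (leqnn _); rewrite /D psumS -/(D o t) => /le_trans; apply.
by rewrite ler_pM2l ?ler_nat //; lra.
Qed.

Lemma hub_o_served t : (t1 <= t <= T)%N -> t%:R - t1%:R <= psum (r o) t.
Proof.
move=> /andP[]; elim: t => [|t IH].
  by rewrite leqn0 => /eqP -> _; rewrite psum0 subrr.
rewrite leq_eqVlt => /orP[/eqP <- _|].
  by rewrite subrr; apply: sumr_ge0 => u _; exact: (r_ge0 H).
rewrite ltnS => t1t tT; have := IH t1t (ltnW tT); rewrite psumS -natr1.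
have -> : r o t = 1 by apply: (hub_first H); apply: dom; rewrite t1t.
lra.
Qed.

(** Up to errors the other hub receives [S + a * T] jobs in all and serves one per step, while
    [v * x o j] grows at rate [v * p]. Hence [w] is the rate at which the lead of the hub shrinks
    once side [c] is drained. *)
Let w := 1 - a + v * p.

(** The lead of the hub comes from at most [z o 0 + S] jobs plus the arrivals at side [c], and it is
    lost at rate [w]; so domination cannot last longer than a multiple of [S]. *)
Lemma dominated_time j : v * x o j T < z o T ->
  w * T%:R <= (v + 2) * S + n * h + t1%:R + v * h + v ^+ 2 * t1%:R.
Proof.
consts; move=> xz.
have zoE := z_psum H o T; rewrite negbK -/(D c T) in zoE.
have Ro := @hub_o_served T; rewrite t1T leqnn in Ro; have {}Ro := Ro isT.
have Nc := sum_noise_le c T_le; have := sum_x_ge0 H c T; rewrite -/(X c T) X_psum SE => Xc.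
have xj := x_psum_ge o j T_le; have Do := served_o_early (leqnn T).
have xj' : v * (p * T%:R - h - v * t1%:R) <= v * x o j T by rewrite ler_pM2l; lra.
have zo := hub_o0.
by rewrite /w; lra.
Qed.

Hypothesis long : v * t1%:R + small_bound < S.
Variable i : 'I_J.
Hypothesis i_top : z o T <= v * x o i T.

(** Otherwise side [c] is large throughout: before [t1] because of [long], afterwards by assumption.
    Then [hub_dominates] applies at time [T] and contradicts [i_top]. *)
Lemma drains : exists2 u, (t1 <= u <= T)%N & W u <= small_bound.
Proof.
apply: contrapT => /forall2NP nex.
have big u : (u < T)%N -> small_bound < W u.
  move=> uT; case: (nex u) => [|/negP]; last by rewrite -ltNge.
  move=> /negP; rewrite (ltnW uT) andbT -ltnNge => ut1.
  have Dc : D c u <= v * u%:R.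
    consts; elim: u uT ut1 => [|u IHu] uT ut; first by rewrite /D psum0 mulr0.
    rewrite /D psumS -/(D c u) -natr1; have := IHu (ltnW uT) (ltnW ut).
    have := sum_g_le H c u; lra.
  have Nc : 0 <= N c u.
    by apply: sumr_ge0 => j _; apply: sumr_ge0 => k _; exact: (e_ge0 H).
  consts; rewrite /W X_psum SE; have := z_ge0 H c u; have := long.
  have : v * u%:R <= v * t1%:R by rewrite ler_pM2l ?ler_nat 1?ltnW //; lra.
  lra.
have TC : time_const * h < T%:R by apply: lt_le_trans t1_gt _; rewrite ler_nat.
by have := hub_dominates big T_le TC i; rewrite ltNge i_top.
Qed.

(** While the queues [x o j] are not served, side [c] is fed by external arrivals only, at rate
    [a < 1], and loses at least one job per step when nonempty. *)
Lemma stays_drained : W T <= empty_const * h.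
Proof.
consts; have [u0 /andP[t1u u0T] Wu0] := drains.
(* As for a reflected random walk, [u] is [u0] or the step following the last time at which the side
   was empty. *)
have reflect t : (u0 <= t <= T)%N -> exists2 u, (u <= t)%N &
    W t <= small_bound + (N c t - N c u) - (t%:R - u%:R).
  move=> /andP[]; elim: t => [|t IH].
    by rewrite leqn0 => /eqP u00 _; exists 0%N => //; move: Wu0; rewrite u00; lra.
  rewrite leq_eqVlt => /orP[/eqP <- _|]; first by exists u0 => //; lra.
  rewrite ltnS => u0t tT; have [u ut Wt] := IH u0t (ltnW tT).
  have WS : W t.+1 = W t - r c t - \sum_j g c j t + \sum_j e c j t.
    rewrite /W /X (sum_xS H) (zS H) -/o served_o_late; first by lra.
    by rewrite tT (leq_trans t1u).
  have NS : N c t.+1 = N c t + \sum_j e c j t.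
    by rewrite -big_split; apply: eq_bigr => j _; rewrite psumS.
  have [W0|W0] := ltP 0 (W t).
    exists u; first exact: leqW.
    have := nonidling H W0; rewrite WS NS -natr1; lra.
  exists t.+1 => //; rewrite WS.
  have := sum_e_le H c t; have := r_ge0 H c t; have := sum_g_ge0 H c t.
  rewrite -nE /small_bound; have : n <= n * v by rewrite ler_peMr //; lra.
  lra.
have [|u uT WT] := reflect T; first by rewrite u0T leqnn.
have := sum_noise_le c T_le; have := sum_noise_ge c (le_tmax uT).
have : small_bound <= small_bound * h by rewrite ler_peMr // /small_bound; lra.
have : a * (T%:R - u%:R) <= T%:R - u%:R.
  by rewrite ler_piMl ?subr_ge0 ?ler_nat //; lra.
rewrite /empty_const; lra.
Qed.

(** The queue [i] has caught up with the hub, and by [x_balanced] it exceeds every other queue of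
    its side by a multiple of [h] only, so it is comparable with their average. The 4 in [hub_const]
    counts four noise bounds. *)
Lemma next_hub : n * z o T <= v * X o T + hub_const * h.
Proof.
consts; have balance j : x o i T - x o j T <= (empty_const + v + 4) * h.
  have [u uT xij] := x_balanced H o T i j (ltW (lt_trans ltr01 v_gt1)).
  have := noise_le o i T_le; have := noise_ge o j T_le.
  have := noise_ge o i (le_tmax uT); have := noise_le o j (le_tmax uT).
  have : v <= v * h by rewrite ler_peMr //; lra.
  have := empty0; lra.
have top : n * x o i T <= X o T + n * ((empty_const + v + 4) * h).
  have -> : n * x o i T = \sum_(j < J) x o i T.
    by rewrite sumr_const card_ord -[_ *+ J]mulr_natl nE.
  have -> : n * ((empty_const + v + 4) * h) = \sum_(j < J) ((empty_const + v + 4) * h).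
    by rewrite sumr_const card_ord -[_ *+ J]mulr_natl nE.
  by rewrite -big_split; apply: ler_sum => j _ /=; have := balance j; lra.
have top' : v * (n * x o i T) <= v * (X o T + n * ((empty_const + v + 4) * h)).
  by rewrite ler_pM2l //; lra.
have zx : n * z o T <= n * (v * x o i T) by rewrite ler_pM2l; [exact: i_top|lra].
rewrite /hub_const; lra.
Qed.

(** As side [c] is drained, nearly all its [S + a * T] jobs have reached the other hub. That hub
    serves at most [T] of them and has nevertheless come down to [v * x o i T]. *)
Lemma cycle_time_ge : S - (n + empty_const + v * (empty_const + 1)) * h <= w * T%:R.
Proof.
consts; have zoE := z_psum H o T; rewrite negbK -/(D c T) in zoE.
have Ro := psum_r_le H o T; have zo := z_ge0 H o 0.
have Nc := sum_noise_ge c T_le; have WT := stays_drained; have zc := z_ge0 H c T.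
rewrite /W X_psum SE in WT.
have xi := x_o_le i T_le.
have xi' : v * x o i T <= v * ((empty_const + 1) * h + p * T%:R) by rewrite ler_pM2l //; lra.
have it := i_top; rewrite /w; lra.
Qed.

Lemma sum_o_ge t : (t <= T)%N -> a * t%:R - (n + v * (time_const + 1)) * h <= X o t.
Proof.
consts; move=> tT; have := sum_noise_ge o (le_tmax tT).
have : v * t1%:R <= v * ((time_const + 1) * h) by rewrite ler_pM2l; [exact: t1_le|lra].
have := served_o_early tT; have := sum_x_ge0 H o 0; rewrite X_psum -/(X o 0); lra.
Qed.

(** Service at a queue of side [c] only moves a job to the other hub, so this sum loses jobs at that
    hub alone, at most one per step. *)
Lemma total_ge t : S - t%:R <= X c t + z o t.
Proof.
rewrite X_psum SE (z_psum H) negbK -/(D c t).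
have := psum_r_le H o t; have := z_ge0 H o 0.
have : 0 <= N c t by apply: sumr_ge0 => j _; apply: sumr_ge0 => k _; exact: (e_ge0 H).
lra.
Qed.
End Cycle.

(** * Growth over one half period, with constants uniform in the path *)

Lemma nat_between (R : realType) (y : R) : 0 <= y -> exists k : nat, y < k%:R <= y + 1.
Proof.
move=> y0; exists (Num.truncn y).+1; rewrite truncnS_gt /= -natr1 lerD2r.
by rewrite truncn_le.
Qed.

(** [T] is the first time after [t1] at which some queue of the other side catches up with its hub.
    Then [S'] is about [a * T] by [sum_o_ge], and [w * T] is about at least [S] by [cycle_time_ge];
    as [w < a], the stock grows by a fraction of [T]. *)
Lemma cycle_growth (R : realType) (J : nat) (n v a p : R) (nE : n = J%:R)
    (v_gt1 : 1 < v) (v_lt : v < n) (a_gt0 : 0 < a) (a_lt1 : a < 1) (npE : n * p = a)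
    (drift_gap_gt0 : 0 < drift_gap n v a p) (grow : 1 - a + v * p < a) :
  exists C3 C4 c3 : R, [/\ 1 <= C3, 0 < C4, 0 < c3 <= 1 &
    forall (z r : bool -> nat -> R) (x g e : bool -> 'I_J -> nat -> R)
      (H : path_spec v z r x g e) (c : bool) (h S : R),
    1 <= h -> C3 * h <= S ->
    (forall b j t, t%:R <= C4 * S -> `|psum (e b j) t - p * t%:R| <= h) ->
    n * z c 0 <= v * S + hub_const n v * h ->
    \sum_j x (~~ c) j 0 <= empty_const n v * h ->
    \sum_j x c j 0 = S -> z (~~ c) 0 <= (v + 1) * S ->
    exists T : nat, let S' := \sum_j x (~~ c) j T in
    [/\ (0 < T)%N,
        n * z (~~ c) T <= v * S' + hub_const n v * h /\ z c T <= (v + 1) * S',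
        \sum_j x c j T <= empty_const n v * h,
        S + c3 * T%:R <= S' &
        forall t, (t <= T)%N ->
          a / 4 * S <= z (~~ c) t + \sum_j x c j t + \sum_j x (~~ c) j t]].
Proof.
have n_gt0 : 0 < n by lra.
have p_gt0 : 0 < p by rewrite -(pmulr_rgt0 _ n_gt0) npE.
have vp_gt0 : 0 < v * p by apply: mulr_gt0; lra.
have nv_gt0 : 0 < n * v by apply: mulr_gt0; lra.
have vv_gt0 : 0 < v ^+ 2 by apply: exprn_gt0; lra.
have L0 : 0 < small_bound n v by rewrite /small_bound; lra.
have E0 : 0 < empty_const n v by rewrite /empty_const; lra.
have hc0 : 0 < hub_const n v by rewrite /hub_const mulr_gt0 // ?(mulrC v) //; lra.
have sc0 : 0 < serve_const n v.
  have : 0 < n * (empty_const n v + n) by apply: mulr_gt0; lra.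
  by rewrite /serve_const; lra.
have tc0 : 0 < time_const n v a p.
  rewrite /time_const divr_gt0 // addr_gt0 // !mulr_gt0 //; lra.
have w_gt0 : 0 < 1 - a + v * p by lra.
set w := 1 - a + v * p in grow w_gt0 *.
set tc := time_const n v a p in tc0.
set E := empty_const n v in E0 *.
(* [CY] and [CZ] are the error constants of [sum_o_ge] and [cycle_time_ge]. *)
pose CY := n + v * (tc + 1); pose CZ := n + E + v * (E + 1).
have vtc : 0 < v * (tc + 1) by apply: mulr_gt0; lra.
have vvtc : 0 < v ^+ 2 * (tc + 1) by apply: mulr_gt0; lra.
have CY0 : 0 < CY by rewrite /CY; lra.
have CZ0 : 0 < CZ by rewrite /CZ; have : 0 < v * (E + 1) by [apply: mulr_gt0; lra]; lra.
(* The bound [m1 * h <= S] makes [(CY + CZ) * h] at most half of [(a - w) * T], and [m2 * h <= S]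
   makes [CY * h] at most [a / 4 * S]. *)
pose m1 := CZ + 2 * w * (CY + CZ) / (a - w); pose m2 := 4 * CY / a.
have m10 : 0 < m1 by rewrite addr_gt0 // divr_gt0 ?subr_gt0 // !mulr_gt0 // addr_gt0.
have m20 : 0 < m2 by rewrite divr_gt0 ?mulr_gt0.
exists (1 + v * (tc + 1) + small_bound n v + n + (tc + 1) + v + v ^+ 2 * (tc + 1) + m1 + m2 + E).
(* By [dominated_time] the half period ends before about [(v + 2) / w * S]; the value 3 absorbs the
   errors, and the summand 1 the rounding up to the integer [t0]. *)
exists ((v + 3) / w + 1), ((a - w) / 2).
have vw : 1 <= (v + 3) / w by rewrite ler_pdivlMr //; lra.
split; [lra|lra|lra|].
move=> z r x g e H c h S h1.
set C3 := (X in X * h <= _) => C3S noise hub0 empty0 XS hubo.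
have hpos : 0 < h by lra.
have bound k : k <= C3 -> k * h <= S by move=> kC; apply: le_trans C3S; rewrite ler_pM2r.
have /bound hS : 1 <= C3 by rewrite /C3; lra.
have S0 : 0 < S by lra.
have /bound hm1 : m1 <= C3 by rewrite /C3; lra.
have /bound hm2 : m2 <= C3 by rewrite /C3; lra.
have /bound hE : E <= C3 by rewrite /C3; lra.
have /bound htc : tc + 1 <= C3 by rewrite /C3; lra.
have /bound hwait : n + (tc + 1) + v + v ^+ 2 * (tc + 1) <= C3 by rewrite /C3; lra.
have /bound hlong : v * (tc + 1) + small_bound n v + n <= C3 by rewrite /C3; lra.
clear bound C3S.
have [t1 /andP[t1_gt t1_le]] : exists k : nat, tc * h < k%:R <= (tc + 1) * h.
  have [|k /andP[k1 k2]] := @nat_between R (tc * h); first by rewrite mulr_ge0 // ltW.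
  by exists k; rewrite k1; lra.
have [|t0 /andP[t0_gt t0_le]] := @nat_between R ((v + 3) / w * S).
  by rewrite mulr_ge0 ?(ltW S0) // (le_trans ler01).
have t0_max : t0%:R <= ((v + 3) / w + 1) * S by lra.
have vt1 : v * t1%:R <= v * (tc + 1) * h by rewrite -mulrA ler_pM2l // (lt_trans ltr01).
have vvt1 : v ^+ 2 * t1%:R <= v ^+ 2 * (tc + 1) * h by rewrite -mulrA ler_pM2l.
have t1t0 : (t1 <= t0)%N.
  rewrite -(ler_nat R); have : S <= (v + 3) / w * S by rewrite ler_peMl // ltW.
  move: htc t1_le t0_gt; clear; lra.
have J0 : (0 < J)%N by rewrite -(ltr_nat R) -nE.
pose ends t := (t1 <= t)%N && [exists j, z (~~ c) t <= v * x (~~ c) j t].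
(* If the hub dominated on all of [[t1, t0]], [dominated_time] at [t0] would contradict the choice
   of [t0]. *)
have exT : exists t, ends t && (t <= t0)%N.
  apply: contrapT => /forallNP none.
  have dom u : (t1 <= u <= t0)%N -> forall j, v * x (~~ c) j u < z (~~ c) u.
    move=> /andP[t1u ut0] j; rewrite ltNge; apply/negP => zx; apply: (none u).
    by rewrite /ends t1u ut0 andbT; apply/existsP; exists j.
  have dom' u : (t1 <= u < t0)%N -> forall j, v * x (~~ c) j u < z (~~ c) u.
    by move=> /andP[t1u ut0]; apply: dom; rewrite t1u ltnW.
  have := dominated_time nE v_gt1 v_lt a_gt0 a_lt1 npE H h1 noise XS hubo t1t0 t0_max dom'
            (dom t0 _ (Ordinal J0)).
  rewrite t1t0 leqnn => /(_ isT).
  have : (v + 3) * S < w * t0%:R.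
    have -> : (v + 3) * S = w * ((v + 3) / w * S) by rewrite mulrA [w * _]mulrC divfK // gt_eqF.
    by rewrite ltr_pM2l.
  rewrite -/w; move: hwait t1_le vvt1; clear; lra.
case: (ex_minnP exT) => T /andP[/andP[t1T /existsP[i zx]] Tt0] Tmin.
have dom u : (t1 <= u < T)%N -> forall j, v * x (~~ c) j u < z (~~ c) u.
  move=> /andP[t1u uT] j; rewrite ltNge; apply/negP => zxu.
  have /Tmin : ends u && (u <= t0)%N.
    rewrite /ends t1u (leq_trans (ltnW uT) Tt0) andbT.
    by apply/existsP; exists j.
  by rewrite leqNgt uT.
have T_le : T%:R <= ((v + 3) / w + 1) * S by apply: le_trans t0_max; rewrite ler_nat.
have long : v * t1%:R + small_bound n v < S.
  have : small_bound n v <= small_bound n v * h by rewrite ler_peMr // ltW.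
  have : 0 < n * h by rewrite mulr_gt0.
  move: hlong vt1; clear; lra.
have hub0' := hub0; rewrite -XS in hub0'.
have WT := stays_drained nE v_gt1 v_lt a_gt0 a_lt1 npE drift_gap_gt0 H h1 noise hub0' empty0 XS
  t1_gt t1T T_le dom long zx.
have Tge := cycle_time_ge nE v_gt1 v_lt a_gt0 a_lt1 npE drift_gap_gt0 H h1 noise hub0' empty0 XS
  t1_gt t1T T_le dom long zx.
have Xo := sum_o_ge nE v_gt1 v_lt a_gt0 a_lt1 npE H h1 noise t1_le T_le dom.
have hub' := next_hub nE v_gt1 v_lt a_gt0 a_lt1 npE H h1 noise empty0 T_le zx.
rewrite -/w -/CZ in Tge; rewrite -/tc -/CY in Xo; rewrite -/E in WT.
have gapT : 2 * (CY + CZ) * h <= (a - w) * T%:R.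
  move: hm1; have -> : m1 * h = CZ * h + w * (2 * (CY + CZ) * h / (a - w)) by rewrite /m1; ring.
  move=> m1S; have : w * (2 * (CY + CZ) * h / (a - w)) <= w * T%:R.
    by move: m1S Tge; clear; lra.
  by rewrite ler_pM2l // ler_pdivrMr ?subr_gt0 // [T%:R * _]mulrC.
have growth : S + (a - w) / 2 * T%:R <= \sum_j x (~~ c) j T.
  by move: (Xo T (leqnn T)) Tge gapT; clear; lra.
have T0 : 0 <= (a - w) / 2 * T%:R.
  by rewrite mulr_ge0 ?ler0n // divr_ge0 // subr_ge0 ltW.
exists T; split => //.
- rewrite (leq_trans _ t1T) // -(ltr_nat R); apply: le_lt_trans t1_gt.
  by rewrite mulr_ge0 // ltW.
- split=> //; move: (sum_x_ge0 H c T) hE.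
  have : 0 <= v * \sum_j x (~~ c) j T.
    by rewrite mulr_ge0 ?(sum_x_ge0 H) // ltW // (lt_trans ltr01).
  move: growth WT T0; clear; lra.
- by move: WT (z_ge0 H c T); clear; lra.
move=> t tT; have tot := total_ge H XS t; have zo := z_ge0 H (~~ c) t.
have xo := sum_x_ge0 H (~~ c) t; have xc := sum_x_ge0 H c t.
have aS : a * S <= S by rewrite ler_piMl // ltW.
(* Up to time [S / 2] at least half of the stock is still present by [total_ge]; later the fresh
   arrivals at the other side suffice. *)
have [tS|tS] := leP t%:R (S / 2).
  by move: tot tS xo aS S0; clear; lra.
have atS : a * (S / 2) <= a * t%:R by rewrite ler_pM2l // ltW.
move: hm2; have -> : m2 * h = 4 * CY * h / a by rewrite /m2; ring.
rewrite ler_pdivrMr //; move: atS (Xo t tT) zo xc; clear; lra.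
Qed.

(** * Unbounded growth of the oscillation *)

Lemma path_shift (R : realType) (J : nat) (v : R) (z r : bool -> nat -> R)
    (x g e : bool -> 'I_J -> nat -> R) (s : nat) : path_spec v z r x g e ->
  path_spec v (fun c t => z c (s + t)%N) (fun c t => r c (s + t)%N)
    (fun c j t => x c j (s + t)%N) (fun c j t => g c j (s + t)%N)
    (fun c j t => e c j (s + t)%N).
Proof.
by case=> *; constructor=> *; rewrite ?addnS; eauto.
Qed.

Lemma psum_shift (R : realType) (f : nat -> R) (s t : nat) :
  psum (fun u => f (s + u)%N) t = psum f (s + t)%N - psum f s.
Proof.
elim: t => [|t IH]; first by rewrite psum0 addn0 subrr.
by rewrite addnS !psumS IH; ring.
Qed.

(** Half periods are chained, each run with its own noise level [S / C3]. A noise allowance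
    proportional to [m + t] is affordable because the stock grows at least linearly with the elapsed
    time. *)
Lemma escape (R : realType) (J : nat) (n v a p : R) (nE : n = J%:R)
    (v_gt1 : 1 < v) (v_lt : v < n) (a_gt0 : 0 < a) (a_lt1 : a < 1) (npE : n * p = a)
    (drift_gap_gt0 : 0 < drift_gap n v a p) (grow : 1 - a + v * p < a) :
  exists eps k M : R, [/\ 0 < eps, 0 < k &
    forall (z r : bool -> nat -> R) (x g e : bool -> 'I_J -> nat -> R)
      (H : path_spec v z r x g e) (c : bool) (m : R),
    M <= m -> m <= \sum_j x c j 0 ->
    (forall b j t, `|psum (e b j) t - p * t%:R| <= eps * (m + t%:R)) ->
    z c 0 <= k * m -> \sum_j x (~~ c) j 0 <= k * m ->
    z (~~ c) 0 <= (v + 1) * \sum_j x c j 0 ->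
    forall t, a / 4 * m <= \sum_b (z b t + \sum_j x b j t)].
Proof.
have [C3 [C4 [c3 [C31 C40 /andP[c30 c31] cyc]]]] :=
  cycle_growth nE v_gt1 v_lt a_gt0 a_lt1 npE drift_gap_gt0 grow.
have n_gt0 : 0 < n by lra.
have nv0 : 0 < n * v by apply: mulr_gt0; lra.
have v20 : 0 < v ^+ 2 by apply: exprn_gt0; lra.
have ec1 : 1 <= empty_const n v by rewrite /empty_const /small_bound; lra.
have hcn : n <= hub_const n v.
  rewrite /hub_const mulrAC mulrC ler_peMr //; first lra.
  have : 1 * 1 <= v * (empty_const n v + v + 4) by apply: ler_pM; lra.
  lra.
have C30 : 0 < C3 by lra.
have v0 : 0 < v by lra.
clear drift_gap_gt0 grow nE v_lt v_gt1 a_lt1 npE nv0 v20.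
have k0 : 0 < C3^-1 by rewrite invr_gt0.
have D0 : 0 < 2 / c3 + C4 by rewrite addr_gt0 // divr_gt0.
exists (C3^-1 / (2 / c3 + C4)), C3^-1, C3; split => //; first by rewrite divr_gt0.
set eps := _ / _ => z r x g e H c m Mm mS noise zc xo zo.
have eps0 : 0 < eps by rewrite divr_gt0.
have epsE : eps * (2 / c3 + C4) = C3^-1 by rewrite /eps divfK // gt_eqF.
(* The number [l] is fuel for the induction: every half period takes at least one step. The
   invariant [c3 * (m + s) <= S] compares the stock with the elapsed time. *)
suff inv : forall l s b (S := \sum_j x b j s), m <= S -> c3 * (m + s%:R) <= S ->
    n * z b s <= v * S + hub_const n v * (C3^-1 * S) ->
    \sum_j x (~~ b) j s <= empty_const n v * (C3^-1 * S) -> z (~~ b) s <= (v + 1) * S ->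
    forall t, (s <= t < s + l)%N -> a / 4 * m <= \sum_b (z b t + \sum_j x b j t).
  move=> t; apply: (inv t.+1 0%N c) => //.
  - rewrite addr0; apply: le_trans mS; rewrite ler_piMl //; lra.
  - have hS : n * (C3^-1 * m) <= hub_const n v * (C3^-1 * \sum_j x c j 0).
      by apply: ler_pM => //; [exact: ltW|rewrite mulr_ge0 //; lra|rewrite ler_pM2l].
    have : n * z c 0 <= n * (C3^-1 * m) by rewrite ler_pM2l.
    have : 0 <= v * \sum_j x c j 0 by rewrite mulr_ge0 ?(sum_x_ge0 H) ?(ltW v0).
    lra.
  - apply: (le_trans xo); apply: (@le_trans _ _ (C3^-1 * \sum_j x c j 0)).
      by rewrite ler_pM2l.
    by rewrite ler_peMl // mulr_ge0 ?(sum_x_ge0 H) ?(ltW k0).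
  - by rewrite leq0n add0n leqnn.
clear zc xo zo; elim=> [|l IH] s b S mS' c3S hubs emps zs t /andP[st].
  by rewrite addn0 ltnNge st.
have S0 : 0 < S by lra.
have h1 : 1 <= C3^-1 * S by rewrite ler_pdivlMl // mulr1; lra.
have C3h : C3 * (C3^-1 * S) <= S by rewrite mulrA divff ?mul1r // gt_eqF.
case: (cyc _ _ _ _ _ (path_shift s H) b (C3^-1 * S) S h1 C3h);
  rewrite ?addn0 //.
  (* The shifted noise is a difference of two original ones, hence at most
     [eps * (2 * (m + s) + u)]. The invariant and [u <= C4 * S] bound this by
     [eps * (2 / c3 + C4) * S], which is [S / C3]. *)
  move=> b' j u uC; rewrite psum_shift.
  have N1 := noise b' j (s + u)%N; have N2 := noise b' j s.
  have -> : psum (e b' j) (s + u) - psum (e b' j) s - p * u%:R =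
    (psum (e b' j) (s + u)%N - p * (s + u)%:R) - (psum (e b' j) s - p * s%:R).
    by rewrite natrD; ring.
  apply: (le_trans (ler_normB _ _)); apply: (le_trans (lerD N1 N2)).
  rewrite -mulrDr -epsE -mulrA ler_pM2l // natrD.
  have : m + s%:R <= S / c3 by rewrite ler_pdivlMr // mulrC.
  rewrite mulrDl; have -> : 2 / c3 * S = 2 * (S / c3) by ring.
  lra.
move=> T [T0 [hubT zT] xT growT tot] tsl.
have bE u : \sum_b (z b u + \sum_j x b j u) =
    z b u + (z (~~ b) u + \sum_j x b j u + \sum_j x (~~ b) j u).
  by rewrite big_bool /=; case: (b) => /=; clear; lra.
have [tT|Tt] := leqP (t - s) T.
  have : a / 4 * m <= a / 4 * S by rewrite ler_pM2l // divr_gt0.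
  have := tot _ tT; rewrite subnKC // bE; move: (z_ge0 H b t); clear; lra.
set S' := \sum_j x (~~ b) j (s + T)%N in hubT zT growT.
have T0' : 0 <= c3 * T%:R by rewrite mulr_ge0 ?ler0n // ltW.
have SleS' : S <= S' by move: growT T0'; clear; lra.
have SS' : C3^-1 * S <= C3^-1 * S' by rewrite ler_pM2l.
(* The next half period starts at [s + T] with the sides exchanged and a larger stock. *)
apply: (IH (s + T)%N (~~ b)); rewrite ?negbK //.
- exact: le_trans SleS'.
- by rewrite -/S' natrD; move: c3S growT; clear; lra.
- by apply: (le_trans hubT); rewrite lerD2l ler_pM2l // (lt_le_trans n_gt0).
- by apply: (le_trans xT); rewrite ler_pM2l // (lt_le_trans ltr01).
- have -> : (s + T <= t)%N by rewrite -leq_subRL // ltnW.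
  by apply: leq_trans tsl _; rewrite addnS -addnA -addnS leq_add2l -addn1 addnC leq_add2r.
Qed.

(** * MaxWeight schedules *)

Section Side.
Local Open Scope nat_scope.
Variables (J nu z s0 : nat) (x s : 'I_J -> nat).
(** One side at one time: hub length [z], queue lengths [x], schedule [s0], [s]. Optimality is used
    only against the extreme schedules that give all capacity to one queue, as in [hub_opt] and
    [leaf_opt]. *)
Hypothesis feas : nu * s0 + \sum_j s j <= nu.
Hypothesis hub_opt : z <= z * s0 + \sum_j x j * s j.
Hypothesis leaf_opt : forall i, nu * x i <= z * s0 + \sum_j x j * s j.
Hypothesis nu_gt0 : 0 < nu.

Let s0_le1 : s0 <= 1. Proof. by rewrite -(leq_pmul2l nu_gt0) muln1; lia. Qed.

Let s0_cases : (s0 = 0) \/ (s0 = 1 /\ forall j, s j = 0).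
Proof.
case: (posnP s0) => [|s0_gt0]; [by left|right].
have s01 : s0 = 1 by lia.
split=> // j; have : \sum_j s j = 0 by move: feas; rewrite s01; lia.
by move/eqP; rewrite sum_nat_eq0 => /forallP /(_ j) /eqP.
Qed.

Lemma side_hub_le1 : minn s0 z <= 1. Proof. lia. Qed.

Lemma side_leaf_le : \sum_j minn (s j) (x j) <= nu.
Proof.
apply: (@leq_trans (\sum_j s j)); last by lia.
by apply: leq_sum => j _; exact: geq_minl.
Qed.

Lemma side_hub_no_leaf j : minn s0 z = 1 -> minn (s j) (x j) = 0.
Proof. by case: s0_cases => [->|[_ ->]]; rewrite min0n. Qed.

Lemma side_hub_opt j : minn s0 z = 1 -> nu * x j <= z.
Proof.
case: s0_cases => [->|[s01 s_0] _]; first by rewrite min0n.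
by have := leaf_opt j; rewrite s01 muln1 big1 ?addn0 // => i _; rewrite s_0 muln0.
Qed.

Let M := \max_j x j.

Let x_le_M j : x j <= M. Proof. exact: leq_bigmax. Qed.

Let leaf_slack : \sum_j x j * s j + \sum_j (M - x j) * s j = M * \sum_j s j.
Proof.
rewrite big_distrr -big_split; apply: eq_bigr => j _ /=.
by rewrite -mulnDl subnKC.
Qed.

(** The weight is at most [M * \sum_j s j], hence at most [M * nu], and optimality makes it at least
    [nu * M]. Both inequalities are therefore equalities: only longest queues are scheduled, at full
    capacity if [M] is positive. *)
Let leaf_mode : s0 = 0 -> (forall j, 0 < s j -> x j = M) /\ (0 < M -> \sum_j s j = nu).
Proof.
move=> s00; have nuM : nu * M <= \sum_j x j * s j.
  have [J0|J0] := posnP #|'I_J|.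
    by rewrite /M big1 ?muln0 // => i; have := fintype0 i J0.
  have [i Mi] := bigop.eq_bigmax x J0.
  by rewrite /M Mi; have := leaf_opt i; rewrite s00 muln0.
have sl : \sum_j (M - x j) * s j + M * (nu - \sum_j s j) = 0.
  have sn : \sum_j s j <= nu by lia.
  by rewrite mulnBr; have : M * \sum_j s j <= M * nu; [rewrite leq_mul2l sn orbT|lia].
move/eqP: sl; rewrite addn_eq0 sum_nat_eq0 => /andP[/forallP sl1].
rewrite muln_eq0 => sl2; split=> [j sj|M0]; last by move: sl2; lia.
by have := sl1 j; have := x_le_M j; rewrite muln_eq0; lia.
Qed.

Lemma side_longest i j : 0 < minn (s j) (x j) -> x i <= x j.
Proof.
move=> gj; have sj : 0 < s j by lia.
case: s0_cases => [/leaf_mode[/(_ j sj) -> _]|[_ /(_ j)]]; [exact: x_le_M|lia].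
Qed.

(** Lengths are integers, so [nu * x j] is at most [z - 1]; without the hub the weight times [nu]
    would be at most [(z - 1) * \sum_j s j], too small for [hub_opt]. A queue exists by [0 < J],
    which makes [z] positive. *)
Lemma side_hub_first : 0 < J -> (forall j, nu * x j < z) -> minn s0 z = 1.
Proof.
move=> J0 xz; have z0 : 0 < z by apply: leq_ltn_trans (xz (Ordinal J0)).
case: s0_cases => [s00|[-> _]]; last by lia.
have : nu * z <= \sum_j (nu * x j) * s j.
  rewrite (eq_bigr (fun j => nu * (x j * s j))) => [|j _]; last by rewrite mulnA.
  by rewrite -big_distrr leq_pmul2l //; move: hub_opt; rewrite s00 muln0.
have [|s_gt0] := posnP (\sum_j s j).
  move/eqP; rewrite sum_nat_eq0 => /forallP s_0.
  by rewrite big1 => [|j _]; [lia|rewrite (eqP (s_0 j)) muln0].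
have : \sum_j nu * x j * s j + \sum_j s j <= z * \sum_j s j.
  rewrite big_distrr -big_split; apply: leq_sum => j _ /=.
  by rewrite -[X in _ + X]mul1n -mulnDl leq_mul2r addn1 xz orbT.
have : z * \sum_j s j <= z * nu by rewrite leq_mul2l; apply/orP; right; lia.
lia.
Qed.

Lemma side_nonidling : 0 < z + \sum_j x j ->
  0 < minn s0 z + \sum_j minn (s j) (x j).
Proof.
move=> pos; case: s0_cases => [s00|[s01 s_0]].
  have [all_eq sum_nu] := leaf_mode s00.
  have [M0|M0] := posnP M.
    have x0 j : x j = 0 by have := x_le_M j; lia.
    have X0 : \sum_j x j = 0 by apply: big1 => j _.
    have XS : \sum_j x j * s j = 0 by apply: big1 => j _; rewrite x0.
    by move: hub_opt pos; rewrite s00 X0 XS; lia.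
  have : 0 < \sum_j s j by rewrite sum_nu.
  rewrite lt0n sum_nat_eq0 negb_forall => /existsP[j /= sj].
  by rewrite (bigD1 j) //=; have := all_eq j; lia.
have [z0|z0] := posnP z; last by rewrite s01; lia.
suff : \sum_j x j = 0 by lia.
apply: big1 => i _; have := leaf_opt i.
rewrite z0 mul0n big1 => [|j _]; last by rewrite s_0 muln0.
by rewrite leqn0 muln_eq0; lia.
Qed.

(** When the hub is not scheduled and [M < nu], the queues hold at most [J * nu] jobs and [hub_opt]
    gives [z <= nu ^ 2]. So on a larger side [M] is at least [nu], and every scheduled queue is long
    enough for its service. *)
Lemma side_full_service : nu ^ 2 + J * nu < z + \sum_j x j ->
  nu * minn s0 z + \sum_j minn (s j) (x j) = nu.
Proof.
move=> big; case: s0_cases => [s00|[s01 s_0]]; last first.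
  have : 0 < minn s0 z + \sum_j minn (s j) (x j) by apply: side_nonidling; lia.
  have -> : \sum_j minn (s j) (x j) = 0 by apply: big1 => j _; rewrite s_0 min0n.
  rewrite !addn0 s01 => r_gt0; have -> : minn 1 z = 1 by move: r_gt0; clear; lia.
  exact: muln1.
have [all_eq sum_nu] := leaf_mode s00.
have sn : \sum_j s j <= nu by lia.
have nuM : nu <= M.
  rewrite leqNgt; apply/negP => Mnu.
  have : \sum_j x j <= J * nu.
    apply: (@leq_trans (\sum_(j < J) nu)); last by rewrite sum_nat_const card_ord.
    by apply: leq_sum => j _; apply: leq_trans (x_le_M j) (ltnW Mnu).
  have : M * \sum_j s j <= nu ^ 2 by rewrite -mulnn leq_mul // ltnW.
  by move: hub_opt leaf_slack; rewrite s00; lia.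
rewrite s00 min0n muln0 add0n -sum_nu; last by lia.
apply: eq_bigr => j _; apply/minn_idPl; have [->//|sj] := posnP (s j).
rewrite (all_eq j sj); apply: leq_trans nuM; apply: leq_trans sn.
by rewrite (bigD1 j) //= leq_addr.
Qed.
End Side.

Lemma big_option (T : Type) (idx : T) (op : Monoid.com_law idx) (I : finType)
    (F : option I -> T) :
  \big[op/idx]_i F i = op (F None) (\big[op/idx]_i F (Some i)).
Proof.
rewrite (bigD1 None) //; congr (op _ _).
rewrite (reindex_omap Some id) => [|[i|]] //.
by apply: eq_bigl => i; rewrite eqxx.
Qed.

Lemma big_queue (T : Type) (idx : T) (op : Monoid.com_law idx) (J : nat)
    (F : queue J -> T) :
  \big[op/idx]_i F i =
  \big[op/idx]_(b : bool) op (F (b, None)) (\big[op/idx]_j F (b, Some j)).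
Proof.
rewrite (eq_bigr (fun i : queue J => F (i.1, i.2))) => [|[b o] _] //.
rewrite -(pair_bigA _ (fun b o => F (b, o))) /=.
by apply: eq_bigr => b _; rewrite big_option.
Qed.

Section MaxWeight.
Variables (R : realType) (J nu : nat).
Hypothesis nu_gt0 : (0 < nu)%N.

Lemma schedulesP (s : qvec J) : schedules R nu s <->
  forall c, (nu * s (c, None) + \sum_j s (c, Some j) <= nu)%N.
Proof.
have nu0 : 0 < nu%:R :> R by rewrite ltr0n.
split=> sP c; have := sP c.
  rewrite -(ler_pM2l nu0) mulrDr mulr1 mulrA divff ?gt_eqF // mul1r.
  by rewrite -natr_sum -natrM -natrD ler_nat.
rewrite -(ler_nat R) natrD natrM natr_sum => sP'.
by rewrite -(ler_pM2l nu0) mulrDr mulr1 mulrA divff ?gt_eqF // mul1r.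
Qed.

Variables (q s : qvec J).
Hypothesis s_sched : schedules R nu s.
Hypothesis s_opt : forall s', schedules R nu s' -> (weight q s' <= weight q s)%N.

(** The constraints do not couple the two sides. Replacing the schedule on side [c] alone therefore
    localises the optimality of [s] to that side. *)
Definition patch (c : bool) (f : option 'I_J -> nat) : qvec J :=
  [ffun i : queue J => if i.1 == c then f i.2 else s i].

Lemma patch_opt c f : (nu * f None + \sum_j f (Some j) <= nu)%N ->
  (q (c, None) * f None + \sum_j q (c, Some j) * f (Some j) <=
   q (c, None) * s (c, None) + \sum_j q (c, Some j) * s (c, Some j))%N.
Proof.
move=> ff; have /s_opt : schedules R nu (patch c f).
  apply/schedulesP => b; rewrite !ffunE /=.
  have [->|bc] := eqVneq b c.
    by under eq_bigr do rewrite ffunE /= eqxx.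
  under eq_bigr do rewrite ffunE /= (negbTE bc).
  by move/schedulesP : s_sched; apply.
rewrite /weight !big_queue (bigD1 c) //= [X in (_ <= X)%N](bigD1 c) //=.
rewrite ffunE eqxx; under eq_bigr do rewrite ffunE /= eqxx.
rewrite [X in (_ + X <= _)%N](eq_bigr (fun b => (q (b, None) * s (b, None) +
  \sum_j q (b, Some j) * s (b, Some j))%N)) => [|b bc]; first by rewrite leq_add2r.
rewrite ffunE (negbTE bc); congr (_ + _)%N.
by apply: eq_bigr => j _; rewrite ffunE (negbTE bc).
Qed.

Lemma maxweight_feas c : (nu * s (c, None) + \sum_j s (c, Some j) <= nu)%N.
Proof. by move/schedulesP : s_sched; apply. Qed.

Lemma maxweight_hub c : (q (c, None) <=
  q (c, None) * s (c, None) + \sum_j q (c, Some j) * s (c, Some j))%N.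
Proof.
have := @patch_opt c (fun o => (o == None) : nat).
have -> : (\sum_(j < J) (Some j == None : nat) = 0)%N by apply: big1.
have -> : (\sum_j q (c, Some j) * (Some j == None : nat) = 0)%N.
  by apply: big1 => j _; rewrite muln0.
by rewrite addn0 !muln1 addn0; exact.
Qed.

Lemma maxweight_leaf c i : (nu * q (c, Some i) <=
  q (c, None) * s (c, None) + \sum_j q (c, Some j) * s (c, Some j))%N.
Proof.
have := @patch_opt c (fun o => if o == Some i then nu else 0%N).
rewrite /= (bigD1 i) //= eqxx big1 => [|j ji]; last by rewrite ifN.
rewrite !muln0 addn0 (bigD1 i) //= eqxx big1 => [|j ji]; last by rewrite ifN ?muln0.
by rewrite addn0 add0n mulnC; exact.
Qed.
End MaxWeight.

Lemma maxweight_path (R : realType) (J nu : nat) (q s : nat -> qvec J)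
    (e : nat -> source J -> bool) :
  (0 < J)%N -> (0 < nu)%N ->
  (forall t, schedules R nu (s t)) ->
  (forall t s', schedules R nu s' -> (weight (q t) s' <= weight (q t) (s t))%N) ->
  (forall t, q t.+1 = step (q t) (s t) (fun i => e t i : nat)) ->
  @path_spec R J nu%:R
    (fun c t => (q t (c, None))%:R) (fun c t => (served (q t) (s t) (c, None))%:R)
    (fun c j t => (q t (c, Some j))%:R) (fun c j t => (served (q t) (s t) (c, Some j))%:R)
    (fun c j t => (e t (c, j))%:R).
Proof.
move=> J0 nu0 sched opt dyn.
have F t c := maxweight_feas nu0 (sched t) c.
have A t c := maxweight_hub nu0 (sched t) (opt t) c.
have B t c i := maxweight_leaf nu0 (sched t) (opt t) c i.
constructor=> //.
- by move=> c j t; rewrite lern1 leq_b1.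
- move=> c t; rewrite dyn ffunE /= natrD natrB ?geq_minr //.
  by rewrite natr_sum.
- by move=> c j t; rewrite dyn ffunE /= natrD natrB ?geq_minr.
- move=> c t; have := side_hub_le1 (F t c) (A t c) nu0; rewrite /served.
  by case: minn => [|[|//]] _; [left|right].
- by move=> c t; rewrite -natr_sum ler_nat /served; apply: side_leaf_le (F t c) (A t c) nu0.
- move=> c t /eqP; rewrite pnatr_eq1 => /eqP r1 j; rewrite /served.
  by rewrite (side_hub_no_leaf (F t c) (A t c) nu0 _ r1).
- move=> c t xz; suff -> : served (q t) (s t) (c, None) = 1%N by [].
  apply: (side_hub_first (F t c) (A t c) (B t c) nu0) => // j.
  by have := xz j; rewrite -natrM ltr_nat.
- move=> c j t; rewrite ltr0n => gj i; rewrite ler_nat.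
  exact: (side_longest (F t c) (A t c) (B t c) nu0 i gj).
- move=> c t /eqP; rewrite pnatr_eq1 => /eqP r1 j; rewrite -natrM ler_nat.
  exact: (side_hub_opt (F t c) (A t c) (B t c) nu0 _ r1).
- move=> c t; rewrite -!natr_sum -!natrD ltr0n ler1n => pos.
  exact: (side_nonidling (F t c) (A t c) (B t c) nu0 pos).
- move=> c t; rewrite -!natr_sum -natrX -!natrM -!natrD ltr_nat => big.
  by rewrite (side_full_service (F t c) (A t c) (B t c) nu0 big).
Qed.

(** * Loading one side from an arbitrary state *)

Section Loading.
Variables (R : realType) (J : nat) (v : R).
Variables (z r : bool -> nat -> R) (x g e : bool -> 'I_J -> nat -> R).
Hypothesis H : path_spec v z r x g e.

Definition total_jobs (t : nat) : R := \sum_b (z b t + \sum_j x b j t).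

Lemma total_jobsE t :
  total_jobs t = z true t + \sum_j x true j t + (z false t + \sum_j x false j t).
Proof. by rewrite /total_jobs big_bool. Qed.

Variable m : nat.
Hypothesis load : forall t, (t < m)%N -> forall b j, e b j t = (~~ b)%:R.

Lemma sum_load b t : (t < m)%N -> \sum_j e b j t = (~~ b)%:R * J%:R.
Proof.
move=> tm; under eq_bigr do rewrite load //.
by rewrite sumr_const card_ord mulr_natr.
Qed.

(** Each loading step brings [J] jobs, and jobs leave the network only at the two hubs, at most two
    per step. *)
Lemma total_load t : 2 < J%:R :> R -> (t < m)%N -> total_jobs t < total_jobs t.+1.
Proof.
move=> J2 tm; rewrite !total_jobsE !(zS H) !(sum_xS H) /= !sum_load //=.
by have := r_le1 H true t; have := r_le1 H false t; lra.
Qed.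

(** With [J] arrivals and at most [J - 1] services, the loaded queues gain a job per step. This and
    the next two lemmas provide the starting conditions of [escape] with [false] as the loaded
    side. *)
Lemma loaded_leaves t : v <= J%:R - 1 -> (t <= m)%N -> t%:R <= \sum_j x false j t.
Proof.
move=> vJ; elim: t => [|t IH] tm; first exact: (sum_x_ge0 H).
rewrite (sum_xS H) sum_load //= -natr1.
by have := IH (ltnW tm); have := sum_g_le H false t; lra.
Qed.

(** The hub [z false] is fed only by the queues [x true j], which receive no arrivals during the
    loading. *)
Lemma loaded_rest t : (t <= m)%N -> z false t + \sum_j x true j t <= total_jobs 0.
Proof.
elim: t => [|t IH] tm.
  rewrite total_jobsE; have := z_ge0 H true 0; have := sum_x_ge0 H false 0; lra.
rewrite (sum_xS H) (zS H) sum_load //=.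
by have := IH (ltnW tm); have := r_ge0 H false t; lra.
Qed.

Lemma hub_le t : z true t <= total_jobs 0 + v * t%:R.
Proof.
elim: t => [|t IH].
  rewrite total_jobsE mulr0; have := z_ge0 H false 0.
  have := sum_x_ge0 H false 0; have := sum_x_ge0 H true 0; lra.
rewrite (zS H) /= -natr1.
by have := IH; have := r_ge0 H true t; have := sum_g_le H false t; lra.
Qed.
End Loading.

Lemma never_back (R : realType) (J : nat) (n v a p : R) (nE : n = J%:R)
    (v_gt1 : 1 < v) (v_lt : v <= n - 1) (n_gt2 : 2 < n)
    (a_gt0 : 0 < a) (a_lt1 : a < 1) (npE : n * p = a)
    (drift_gap_gt0 : 0 < drift_gap n v a p) (grow : 1 - a + v * p < a) :
  exists2 eps : R, 0 < eps & forall k : R, 0 <= k -> exists m0 : nat,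
    forall (m : nat) (z r : bool -> nat -> R) (x g e : bool -> 'I_J -> nat -> R),
    (m0 <= m)%N -> path_spec v z r x g e -> total_jobs z x 0 = k ->
    (forall t, (t < m)%N -> forall b j, e b j t = (~~ b)%:R) ->
    (forall b j t, `|\sum_(u < t) e b j (m + u)%N - p * t%:R| <= eps * (m%:R + t%:R)) ->
    forall t, (0 < t)%N -> k < total_jobs z x t.
Proof.
have v_lt' : v < n by lra.
have [eps [l [M [eps0 l0 esc]]]] := escape nE v_gt1 v_lt' a_gt0 a_lt1 npE drift_gap_gt0 grow.
exists eps => // k k0.
have a40 : 0 < a / 4 by rewrite divr_gt0.
(* The summands ensure in turn [k <= m] for [hub_le], [k <= l * m] for [loaded_rest], [M <= m] for
   [escape], and [k < a / 4 * m] for the conclusion. *)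
exists (Num.truncn (k + k / l + `|M| + k / (a / 4))).+1 => m z r x g e m0m H xk load noise t t0.
have big : k + k / l + `|M| + k / (a / 4) < m%:R.
  by apply: lt_le_trans (truncnS_gt _) _; rewrite ler_nat.
have kl0 : 0 <= k / l by rewrite divr_ge0 // ltW.
have ka0 : 0 <= k / (a / 4) by rewrite divr_ge0 // ltW.
have M0 := normr_ge0 M; have MM := ler_norm M.
have [tm|mt] := leqP t m.
  rewrite -xk; elim: t t0 tm => // t IH _ tm.
  have step_up := total_load H load (_ : 2 < J%:R) tm; rewrite -nE in step_up.
  have {}step_up := step_up n_gt2.
  by case: t IH tm step_up => // t IH tm; apply: lt_trans; apply: IH => //; apply: ltnW.
have vJ : v <= J%:R - 1 by rewrite -nE.
have leaves := loaded_leaves H load vJ (leqnn m).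
have rest := loaded_rest H load (leqnn m).
have hub := hub_le H m.
rewrite xk in rest hub.
have klm : k <= l * m%:R by rewrite mulrC -ler_pdivrMr //; lra.
have vX : v * m%:R <= v * \sum_j x false j m by rewrite ler_pM2l //; lra.
have := esc _ _ _ _ _ (path_shift m H) false m%:R.
rewrite !addn0 /= => /(_ _ _ noise) escm.
have {}escm := escm _ _ _ _ _ (t - m)%N.
rewrite subnKC in escm; last exact: ltnW.
clear drift_gap_gt0 grow npE esc.
apply: (lt_le_trans _ (escm _ _ _ _ _)) => //.
- by rewrite mulrC -ltr_pdivrMr //; lra.
- lra.
- have := sum_x_ge0 H true m; lra.
- have := z_ge0 H false m; lra.
- lra.
Qed.

(** * The parameter region *)

Section Region.
Variables (R : realType) (n v a : R).
Hypotheses (v_gt1 : 1 < v) (v_lt : v < n) (a_gt0 : 0 < a).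

Lemma arrival_rate_lt1 : a * (1 + v^-1) < 1 -> a < 1.
Proof.
move=> h; apply: lt_trans h; rewrite ltr_pMr // ltrDl invr_gt0.
by apply: lt_trans v_gt1.
Qed.

Let n_gt0 : 0 < n. Proof. by apply: lt_trans v_lt; apply: lt_trans v_gt1. Qed.

Lemma grow_cond : n / (2 * n - v) < a -> 1 - a + v * (a / n) < a.
Proof.
move: (v_lt) n_gt0 => vn n0; rewrite ltr_pdivrMr; last by lra.
move=> h; rewrite -subr_gt0.
have -> : a - (1 - a + v * (a / n)) = (a * (2 * n - v) - n) / n by field; lra.
by rewrite divr_gt0 // subr_gt0.
Qed.

Lemma drift_gap_cond : a < 1 - (n + v) * (n + v ^+ 2) / (v * (n ^+ 2 + n + v ^+ 2)) ->
  0 < drift_gap n v a (a / n).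
Proof.
move: (v_gt1) n_gt0 => v1 n0 h.
have v0 : 0 < v by lra.
have n20 : 0 < n ^+ 2 by apply: exprn_gt0.
have v20 : 0 < v ^+ 2 by apply: exprn_gt0.
have {}h : (n + v) * (n + v ^+ 2) < (1 - a) * (v * (n ^+ 2 + n + v ^+ 2)).
  by rewrite -ltr_pdivrMr ?mulr_gt0 //; lra.
(* Multiplied by [n], the gap is the quantity made positive by the bound on [a], plus a positive
   term. *)
have -> : drift_gap n v a (a / n) =
    ((1 - a) * (v * (n ^+ 2 + n + v ^+ 2)) - (n + v) * (n + v ^+ 2) + a * (v ^+ 2 * n)) / n.
  by rewrite /drift_gap; field; lra.
by rewrite divr_gt0 // addr_gt0 ?subr_gt0 // !mulr_gt0.
Qed.
End Region.

(** * Subcriticality *)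

Section Hull.
Variables (R : realType) (V : lmodType R) (A : set V).

Lemma hull_convex : convex_set (convex_hull A).
Proof.
move=> x y t; rewrite !inE => Ax Ay B [Bconv AB].
have := Bconv x y t; rewrite !inE; apply; [exact: Ax|exact: Ay].
Qed.

Lemma hull_comb2 (t : R) (x y : V) : 0 <= t -> t <= 1 ->
  convex_hull A x -> convex_hull A y -> convex_hull A (t *: x + (1 - t) *: y).
Proof.
move=> t0 t1 Ax Ay; have := hull_convex (Itv01 t0 t1) => /(_ x y).
by rewrite !inE; apply.
Qed.

(** Induction on the list of points, with partial combinations renormalised by their total weight.
    If the remaining weight [W] vanishes, only the head point contributes. *)
Lemma hull_comb (I : finType) (w : I -> R) (f : I -> V) :
  (forall i, 0 <= w i) -> \sum_i w i = 1 -> (forall i, convex_hull A (f i)) ->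
  convex_hull A (\sum_i w i *: f i).
Proof.
move=> w0 w1 Af; suff seqs (s : seq I) : 0 < \sum_(i <- s) w i ->
    convex_hull A ((\sum_(i <- s) w i)^-1 *: \sum_(i <- s) w i *: f i).
  by have := seqs (index_enum I); rewrite w1 invr1 scale1r; apply.
elim: s => [|i s IH]; first by rewrite big_nil ltxx.
rewrite !big_cons; set W := \sum_(j <- s) w j; move=> pos.
have W0 : 0 <= W by apply: sumr_ge0.
have [Weq|Wneq] := eqVneq W 0.
  have -> : \sum_(j <- s) w j *: f j = 0.
    rewrite big_seq big1 // => j js.
    move/eqP : Weq; rewrite psumr_eq0 // => /allP /(_ _ js) /eqP ->.
    by rewrite scale0r.
  move: pos; rewrite Weq !addr0 => wi.
  by rewrite scalerA mulVf ?scale1r // gt_eqF.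
have {}IH := IH (_ : 0 < W); have {}IH := IH (ltac:(by rewrite lt_neqAle eq_sym Wneq)).
have := @hull_comb2 (w i / (w i + W)) _ _ _ _ (Af i) IH.
rewrite ler_pdivrMr // mul1r lerDl divr_ge0 ?(ltW pos) // => /(_ isT W0).
congr (convex_hull A _); rewrite scalerDr !scalerA; congr (_ *: _ + _ *: _).
  by rewrite mulrC.
by rewrite -/W; field; rewrite Wneq gt_eqF.
Qed.
End Hull.

Section Polytope.
Variables (R : realType) (J nu : nat).
Hypothesis nu_gt0 : (0 < nu)%N.

(* The vertices of one side: [None] serves nothing, [Some o] serves the queue
   [o] at full capacity. *)
Definition vertex (k : option (option 'I_J)) (o : option 'I_J) : nat :=
  if k == Some o then (if o is Some _ then nu else 1%N) else 0%N.

(** The barycentric coordinates of [f] in the simplex with these vertices; the origin takes the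
    slack of the constraint. *)
Definition vertex_weight (f : option 'I_J -> R) (k : option (option 'I_J)) : R :=
  match k with
  | None => 1 - (f None + nu%:R^-1 * \sum_j f (Some j))
  | Some None => f None
  | Some (Some j) => nu%:R^-1 * f (Some j)
  end.

Lemma sum_vertex_weight f : \sum_k vertex_weight f k = 1.
Proof. by rewrite !big_option /= mulr_sumr; ring. Qed.

Lemma sum_vertex_weightM f o : \sum_k vertex_weight f k * (vertex k o)%:R = f o.
Proof.
rewrite (bigD1 (Some o)) //= big1 => [|k ko]; last first.
  by rewrite /vertex (negbTE ko) mulr0.
rewrite addr0 /vertex eqxx; case: o => [j|]; last by rewrite mulr1.
by rewrite mulrAC mulVf ?mul1r // pnatr_eq0 -lt0n.
Qed.

Lemma vertex_sched (k : bool -> option (option 'I_J)) :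
  schedules R nu [ffun i : queue J => vertex (k i.1) i.2].
Proof.
apply/(schedulesP _ nu_gt0) => c; rewrite ffunE /=.
under eq_bigr do rewrite ffunE /=.
case: (k c) => [[j|]|]; rewrite /vertex /=.
- rewrite muln0 add0n (bigD1 j) //= eqxx big1 ?addn0 // => i ij.
  by rewrite ifN //; apply: contraNN ij => /eqP[->].
- by rewrite muln1 big1 ?addn0.
- by rewrite muln0 big1.
Qed.

(** The polytope is a product of two simplices, one per side, so the products of the barycentric
    coordinates express [y] through pairs of vertices, all of which are schedules. *)
Lemma hull_polytope (y : 'rV[R]_#|{: queue J}|) (f := fun i : queue J => y ord0 (enum_rank i)) :
  (forall i, 0 <= f i) ->
  (forall c, f (c, None) + nu%:R^-1 * \sum_j f (c, Some j) <= 1) ->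
  convex_hull [set qrow (fun i => (s i)%:R : R) | s in schedules R nu] y.
Proof.
move=> f0 f1; pose w c := vertex_weight (fun o => f (c, o)).
have w0 c k : 0 <= w c k.
  case: k => [[j|]|]; rewrite /w /= ?f0 //; last by rewrite subr_ge0.
  by rewrite mulr_ge0 ?invr_ge0.
have w1 c : \sum_k w c k = 1 by exact: sum_vertex_weight.
pose pt k l := qrow (fun i : queue J => (vertex (if i.1 then k else l) i.2)%:R : R).
have -> : y = \sum_k w true k *: \sum_l w false l *: pt k l.
  apply/rowP => m; rewrite summxE.
  transitivity (f (enum_val m)); first by rewrite /f enum_valK.
  under eq_bigr => k _ do (rewrite mxE summxE; under eq_bigr => l _ do rewrite !mxE).
  case: (enum_val m) => [[] o] /=.
    transitivity (\sum_k w true k * (vertex k o)%:R); first by rewrite sum_vertex_weightM.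
    by apply: eq_bigr => k _; rewrite -mulr_suml w1 mul1r.
  rewrite -mulr_suml w1 mul1r; exact/esym/(sum_vertex_weightM (fun o => f (false, o))).
apply: hull_comb => // k; apply: hull_comb => // l.
apply: sub_gen_smallest; exists [ffun i : queue J => vertex (if i.1 then k else l) i.2].
  exact: (vertex_sched (fun b => if b then k else l)).
by apply/rowP => m; rewrite !mxE ffunE.
Qed.

Lemma traffic_subcritical (a : R) : (0 < J)%N -> 0 < a -> a * (1 + nu%:R^-1) < 1 ->
  subcritical nu (qrow (traffic (J:=J) a)).
Proof.
move=> J0 a0 h; have nu0 : 0 < nu%:R :> R by rewrite ltr0n.
have J0' : 0 < J%:R :> R by rewrite ltr0n.
have inu0 : 0 < nu%:R^-1 :> R by rewrite invr_gt0.
pose s : R := 1 + nu%:R^-1 * J%:R.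
have s0 : 0 < s by rewrite addr_gt0 // mulr_gt0.
(* The first bound keeps all coordinates nonnegative. In the second, the slack of the capacity
   constraint is divided by the sum [s] of its coefficients. *)
pose eps := Num.min (a / J%:R) ((1 - a * (1 + nu%:R^-1)) / s).
have eps0 : 0 < eps by rewrite lt_min !divr_gt0 // subr_gt0.
apply/nbhs_ballP; exists eps => // y [_ yb].
have near i : `|traffic a i - y ord0 (enum_rank i)| < eps.
  by have := yb ord0 (enum_rank i); rewrite /ball /= /ball_ /= mxE enum_rankK.
have epsJ : eps <= a / J%:R by rewrite ge_min lexx.
have epss : eps * s <= 1 - a * (1 + nu%:R^-1) by rewrite -ler_pdivlMr // ge_min lexx orbT.
apply: hull_polytope => [i|c].
  have := near i; rewrite ltr_norml => /andP[_].
  have : a / J%:R <= traffic a i.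
    rewrite /traffic; case: i.2 => // ; rewrite ler_pdivrMr // ler_peMr ?ler1n //; exact: ltW.
  lra.
have bnd i : y ord0 (enum_rank i) <= traffic a i + eps.
  by have := near i; rewrite ltr_norml => /andP[+ _]; lra.
have sum_le : \sum_j y ord0 (enum_rank (c, Some j)) <= a + J%:R * eps.
  apply: (@le_trans _ _ (\sum_(j < J) (a / J%:R + eps))).
    by apply: ler_sum => j _; exact: bnd.
  by rewrite sumr_const card_ord -[_ *+ J]mulr_natl mulrDr mulrCA divff ?mulr1 // gt_eqF.
have sum_le' := sum_le; rewrite -(ler_pM2l inu0) in sum_le'.
by have := bnd (c, None); rewrite /traffic /=; move: epss; rewrite /s; lra.
Qed.
End Polytope.

(** * A deviation bound for Bernoulli sums *)

Section Chernoff.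
Variables (R : realType) (p : R).
Hypotheses (p_ge0 : 0 <= p) (p_le1 : p <= 1).

Definition bern (b : bool) : R := if b then p else 1 - p.

Lemma bern_ge0 b : 0 <= bern b.
Proof. by case: b; rewrite /= ?subr_ge0. Qed.

(** [expR x] is at most [(1 - x)^-1], and [(1 + x + 2 * x ^+ 2) * (1 - x) = 1 + x ^+ 2 * (1 - 2 *
    x)] is at least 1. *)
Lemma expR_le_quad (x : R) : `|x| <= 1 / 2 -> expR x <= 1 + x + 2 * x ^+ 2.
Proof.
rewrite ler_norml => /andP[x1 x2]; have x0 : 0 < 1 - x by lra.
have : expR x <= (1 - x)^-1.
  rewrite -[expR x]invrK -expRN lef_pV2 ?posrE ?expR_gt0 //.
  exact: expR_ge1Dx.
move=> /le_trans; apply; rewrite -div1r ler_pdivrMr //.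
have : 0 <= x ^+ 2 * (1 - 2 * x) by rewrite mulr_ge0 ?sqr_ge0 //; lra.
by rewrite !expr2; lra.
Qed.

(** The linear terms cancel by centring, and the quadratic ones leave the variance [p * (1 - p)],
    which is at most 1. *)
Lemma bern_mgf (l : R) : `|l| <= 1 / 2 ->
  \sum_(b : bool) bern b * expR (l * (b%:R - p)) <= expR (2 * l ^+ 2).
Proof.
move=> hl; move: (p_ge0) (p_le1) => p0 p1.
have small (y : R) : `|y| <= 1 -> `|l * y| <= 1 / 2.
  by move=> y1; rewrite normrM -[1 / 2]mulr1; apply: ler_pM.
have e1 : expR (l * (1 - p)) <= 1 + l * (1 - p) + 2 * (l * (1 - p)) ^+ 2.
  by apply: expR_le_quad; apply: small; rewrite ler_norml; apply/andP; split; lra.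
have e0 : expR (l * (0 - p)) <= 1 + l * (0 - p) + 2 * (l * (0 - p)) ^+ 2.
  by apply: expR_le_quad; apply: small; rewrite ler_norml; apply/andP; split; lra.
rewrite big_bool /=; apply: (le_trans _ (expR_ge1Dx _)).
have q0 : 0 <= 1 - p by lra.
have := lerD (ler_wpM2l p0 e1) (ler_wpM2l q0 e0); move=> /le_trans; apply.
have l2 : 0 <= l ^+ 2 by exact: sqr_ge0.
have pq : 0 <= p * (1 - p) by exact: mulr_ge0.
have -> : p * (1 + l * (1 - p) + 2 * (l * (1 - p)) ^+ 2) +
   (1 - p) * (1 + l * (0 - p) + 2 * (l * (0 - p)) ^+ 2) =
   1 + 2 * l ^+ 2 * (p * (1 - p)) by ring.
rewrite lerD2l; apply: ler_piMr; first by rewrite mulr_ge0.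
by have := sqr_ge0 p; rewrite expr2 mulrBr mulr1; lra.
Qed.

Lemma bern_sum_mgf (t : nat) (l : R) : `|l| <= 1 / 2 ->
  \sum_(f : {ffun 'I_t -> bool}) \prod_u bern (f u) * expR (l * (\sum_u (f u)%:R - p * t%:R))
    <= expR (2 * l ^+ 2 * t%:R).
Proof.
move=> hl; rewrite (eq_bigr (fun f : {ffun 'I_t -> bool} =>
    \prod_u (bern (f u) * expR (l * ((f u)%:R - p))))) => [|f _]; last first.
  rewrite big_split /=; congr (_ * _); rewrite -expR_sum -mulr_sumr sumrB.
  by rewrite sumr_const card_ord mulr_natr.
rewrite -(bigA_distr_bigA (fun _ b => bern b * expR (l * (b%:R - p)))) /=.
rewrite prodr_const card_ord [2 * _ * _]mulrC expRM_natl.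
rewrite lerXn2r ?nnegrE ?expR_ge0 ?bern_mgf // sumr_ge0 // => b _.
by rewrite mulr_ge0 ?bern_ge0 ?expR_ge0.
Qed.

(** Chernoff bound for both tails. The allowance grows with [m] and [t], so the bound is summable
    over [t] and its sum is small for large [m]. *)
Lemma bern_deviation (eps : R) : 0 < eps -> exists2 d : R, 0 < d < 1 &
  forall m t : nat,
  \sum_(f : {ffun 'I_t -> bool} | eps * (m%:R + t%:R) < `|\sum_u (f u)%:R - p * t%:R|)
     \prod_u bern (f u) <= 2 * d ^+ m * d ^+ t.
Proof.
(* With [l <= eps / 4], the moment bound [2 * l ^+ 2 * t] costs at most half of the exponent
   [l * eps * t]; the other half gives [d ^+ t]. *)
move=> eps0; pose l := Num.min (1 / 2) (eps / 4).
have l0 : 0 < l by rewrite lt_min !divr_gt0.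
have l1 : l <= 1 / 2 by rewrite ge_min lexx.
have l2 : l <= eps / 4 by rewrite ge_min lexx orbT.
have le0 : 0 < l * eps / 2 by rewrite divr_gt0 // mulr_gt0.
exists (expR (- (l * eps / 2))); first by rewrite expR_gt0 expR_lt1 oppr_lt0.
move=> m t; set d := expR _.
have m0 : 0 <= m%:R :> R by exact: ler0n.
have t0 : 0 <= t%:R :> R by exact: ler0n.
pose E k := \sum_(f : {ffun 'I_t -> bool})
  \prod_u bern (f u) * expR (k * (\sum_u (f u)%:R - p * t%:R)).
pose c := expR (- (l * (eps * (m%:R + t%:R)))).
have pr0 (f : {ffun 'I_t -> bool}) : 0 <= \prod_u bern (f u).
  by apply: prodr_ge0 => u _; exact: bern_ge0.
apply: (@le_trans _ _ (c * (E l + E (- l)))).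
  rewrite /E -big_split /= mulr_sumr big_mkcond /=; apply: ler_sum => f _.
  set y := \sum_u _ - _; case: ifP => [|_]; last first.
    by rewrite mulr_ge0 ?expR_ge0 // addr_ge0 // mulr_ge0 ?expR_ge0.
  rewrite -mulrDr mulrCA => dev; rewrite ler_peMr //.
  rewrite mulrDr -!expRD; have [y0|y0] := leP 0 y.
    rewrite ger0_norm // in dev.
    apply: ler_wpDr; first exact: expR_ge0.
    rewrite -[X in X <= _]expR0 ler_expR; rewrite -(ltr_pM2l l0) in dev; lra.
  rewrite ltr0_norm // in dev.
  apply: ler_wpDl; first exact: expR_ge0.
  rewrite -[X in X <= _]expR0 ler_expR; rewrite -(ltr_pM2l l0) in dev; lra.
have El : E l <= expR (2 * l ^+ 2 * t%:R) by apply: bern_sum_mgf; rewrite gtr0_norm.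
have EN : E (- l) <= expR (2 * l ^+ 2 * t%:R).
  by rewrite -[l in leRHS]opprK sqrrN; apply: bern_sum_mgf; rewrite normrN gtr0_norm.
apply: (@le_trans _ _ (c * (2 * expR (2 * l ^+ 2 * t%:R)))).
  by rewrite ler_pM2l ?expR_gt0 //; lra.
rewrite mulrCA -[leRHS]mulrA ler_pM2l // /c /d -!expRM_natl -!expRD ler_expR.
have lt2 : 2 * l ^+ 2 * t%:R <= l * eps / 2 * t%:R.
  rewrite ler_wpM2r // expr2.
  by have : l * l <= l * (eps / 4) by [rewrite ler_pM2l]; lra.
have lm : 0 <= l * eps / 2 * m%:R by rewrite mulr_ge0 // ltW.
lra.
Qed.
End Chernoff.

(** * The arrival process *)

Lemma measure_bigsetU_le (d : measure_display) (T : ringOfSetsType d) (R : realFieldType)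
    (mu : {content set T -> \bar R}) (I : Type) (s : seq I) (Q : pred I) (F : I -> set T) :
  (forall i, measurable (F i)) ->
  (mu (\big[setU/set0]_(i <- s | Q i) F i) <= \sum_(i <- s | Q i) mu (F i))%E.
Proof.
move=> mF; elim: s => [|i s IH]; first by rewrite !big_nil measure0.
rewrite !big_cons; case: ifP => // _; apply: le_trans (leeD2l _ IH).
by apply: measureU2 => //; apply: bigsetU_measurable.
Qed.

Section Noise.
Variables (R : realType) (J : nat) (a : R).
Variables (d d' : measure_display) (Omega : measurableType d) (U : measurableType d').
Variables (P : probability Omega R) (xi : nat -> {mfun Omega >-> U}).
Variable arr : nat -> source J -> {mfun Omega >-> bool}.
Hypothesis noise : network_noise a P xi arr.
Let p := a / J%:R.

Definition arr_at (k : nat * source J) (b : bool) : set Omega := [set w | arr k.1 k.2 w = b].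

Lemma measurable_arr_at k b : measurable (arr_at k b).
Proof. by have := measurable_funPTI (arr k.1 k.2) (Y := [set b]); apply. Qed.

Lemma prob_arr_at k b : P (arr_at k b) = (bern p b)%:E.
Proof.
have Pt : P (arr_at k true) = p%:E.
  have [_ mean _] := noise; rewrite -(mean k.1 k.2) unlock.
  rewrite -[arr_at k true]setIT -integral_indic //; last exact: measurable_arr_at.
  apply: eq_integral => w _; rewrite indicE; congr (_%:R%:E).
  rewrite /arr_at; case: (boolP (arr _ _ w)) => h.
    by rewrite mem_set.
  by rewrite memNset //= => h'; rewrite h' in h.
case: b => //=; have -> : arr_at k false = ~` arr_at k true.
  by apply/seteqP; split=> w; rewrite /arr_at /=; case: (arr k.1 k.2 w).
by rewrite probability_setC ?Pt //; exact: measurable_arr_at.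
Qed.

Lemma prob_arr_all (s : seq (nat * source J)) (f : nat * source J -> bool) : uniq s ->
  P (\bigcap_(k in [set` s]) arr_at k (f k)) = (\prod_(k <- s) bern p (f k))%:E.
Proof.
move=> us; have [indep _ _] := noise.
pose E (k : nat + nat * source J) := if k is inr k then arr_at k (f k) else setT.
have := indep (map inr s) E; rewrite map_inj_uniq => [|k l []] // => /(_ us).
have -> : \bigcap_(i in [set` map inr s]) E i = \bigcap_(k in [set` s]) arr_at k (f k).
  apply/seteqP; split=> w wE k /= ks.
    by apply: (wE (inr k)); rewrite /= mem_map // => ? ? [].
  by case/mapP: ks => l ls ->; exact: wE.
move=> ->.
  rewrite big_map -prodEFin; apply: eq_bigr => k _; exact: prob_arr_at.
move=> _ /mapP[[t i] _ ->]; exists [set f (t, i)] => //.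
by rewrite setTI.
Qed.

Variable m : nat.

Definition loading : seq (nat * source J) :=
  [seq (u, i) | u <- iota 0 m, i <- enum {: source J}].

Definition loaded : set Omega := \bigcap_(k in [set` loading]) arr_at k (~~ k.2.1).

Definition deviates (eps : R) (t : nat) (i : source J) : set Omega :=
  [set w | eps * (m%:R + t%:R) < `|\sum_(u < t) (arr (m + u) i w)%:R - p * t%:R|].

Definition window (t : nat) (i : source J) : seq (nat * source J) :=
  [seq ((m + u)%N, i) | u <- iota 0 t].

Lemma mem_loading k : (k \in loading) = (k.1 < m)%N.
Proof.
case: k => u i; apply/allpairsP/idP => [[[u' i'] /= [+ _ [-> _]]]|um].
  by rewrite mem_iota.
by exists (u, i); rewrite /= mem_iota mem_enum.
Qed.

Lemma uniq_loading : uniq loading.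
Proof. by rewrite allpairs_uniq ?iota_uniq ?enum_uniq // => -[? ?] [? ?] _ _ /= [-> ->]. Qed.

Lemma uniq_load_window t i : uniq (loading ++ window t i).
Proof.
rewrite cat_uniq uniq_loading /=; apply/andP; split.
- rewrite -all_predC; apply/allP => k /mapP[u _ ->] /=.
  by rewrite mem_loading /= -leqNgt leq_addr.
- by rewrite map_inj_uniq ?iota_uniq // => u u' [/addnI].
Qed.

Lemma measurable_loaded : measurable loaded.
Proof.
by apply: fin_bigcap_measurable => [|k _]; [exact: finite_seq|exact: measurable_arr_at].
Qed.

(** The loading pattern before time [m], then [f] shifted by [m]; [false] is the default value
    beyond the window. *)
Definition pattern t (f : {ffun 'I_t -> bool}) (k : nat * source J) : bool :=
  if (k.1 < m)%N then ~~ k.2.1 else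
  if insub (k.1 - m)%N is Some u then f u else false.

Definition cylinder t i (f : {ffun 'I_t -> bool}) : set Omega :=
  \bigcap_(k in [set` loading ++ window t i]) arr_at k (pattern f k).

Lemma cylinderP t i f w : cylinder i f w <->
  loaded w /\ forall u : 'I_t, arr (m + u) i w = f u.
Proof.
split=> [wc|[wl wf] k /=].
  split=> [k kl|u].
    have := wc k; rewrite /= mem_cat kl /pattern => /(_ isT).
    by move: kl; rewrite /= mem_loading => ->.
  have := wc ((m + u)%N, i); rewrite /= mem_cat map_f ?orbT ?mem_iota //= => /(_ isT).
  by rewrite /arr_at /pattern /= ltnNge leq_addr addKn valK.
rewrite mem_cat => /orP[kl|/mapP[u]].
  by have := wl k kl; move: kl; rewrite mem_loading /pattern => ->.
rewrite mem_iota /= => ut ->; rewrite /arr_at /pattern /= ltnNge leq_addr addKn.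
by rewrite insubT; exact: (wf (Ordinal ut)).
Qed.

Lemma measurable_cylinder t i f : measurable (@cylinder t i f).
Proof.
by apply: fin_bigcap_measurable => [|k _]; [exact: finite_seq|exact: measurable_arr_at].
Qed.

Lemma prob_loaded : P loaded = (\prod_(k <- loading) bern p (~~ k.2.1))%:E.
Proof.
exact: (prob_arr_all (fun k => ~~ k.2.1) uniq_loading).
Qed.

Lemma prob_cylinder t i f :
  P (@cylinder t i f) = (fine (P loaded) * \prod_u bern p (f u))%:E.
Proof.
rewrite prob_arr_all ?uniq_load_window // prob_loaded big_cat /=; congr (_ * _)%:E.
  rewrite !big_seq; apply: eq_bigr => k; rewrite mem_loading /pattern => -> //.
rewrite big_map -[t in iota 0 t](subn0 t) -/(index_iota 0 t) big_mkord.
by apply: eq_bigr => u _; rewrite /pattern /= ltnNge leq_addr addKn valK.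
Qed.

Lemma loaded_deviates eps t i : loaded `&` deviates eps t i =
  \big[setU/set0]_(f : {ffun 'I_t -> bool} |
    eps * (m%:R + t%:R) < `|\sum_u (f u)%:R - p * t%:R|) cylinder i f.
Proof.
rewrite -bigcup_seq_cond; apply/seteqP; split=> w /=.
  move=> [wl wd]; exists [ffun u : 'I_t => arr (m + u) i w].
    rewrite /= mem_index_enum /=; under eq_bigr do rewrite ffunE; exact: wd.
  by apply/cylinderP; split=> // u; rewrite ffunE.
move=> [f /andP[_ fd] /cylinderP[wl wf]]; split=> //.
by rewrite /deviates /=; under eq_bigr do rewrite wf.
Qed.

Lemma measurable_loaded_deviates eps t i : measurable (loaded `&` deviates eps t i).
Proof.
by rewrite loaded_deviates; apply: bigsetU_measurable => f _; exact: measurable_cylinder.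
Qed.

(** A union bound over cylinders. By independence each one carries the factor [P loaded], so the
    estimate is in effect conditional on the loading, however unlikely that is. *)
Lemma prob_loaded_deviates (eps D : R) t i :
  (\sum_(f : {ffun 'I_t -> bool} | eps * (m%:R + t%:R) < `|\sum_u (f u)%:R - p * t%:R|)
     \prod_u bern p (f u) <= D) ->
  (P (loaded `&` deviates eps t i) <= (fine (P loaded) * D)%:E)%E.
Proof.
move=> fD; rewrite loaded_deviates.
apply: (le_trans (measure_bigsetU_le _ _ _ _)); first by move=> f; exact: measurable_cylinder.
rewrite (eq_bigr (fun f : {ffun 'I_t -> bool} =>
    (fine (P loaded) * \prod_u bern p (f u))%:E)) => [|f _]; last exact: prob_cylinder.
rewrite sumEFin lee_fin -mulr_sumr; apply: ler_wpM2l => //.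
exact: fine_ge0.
Qed.
End Noise.

(** * A good event of positive probability *)

Section Event.
Variables (R : realType) (J : nat) (a : R).
Variables (d d' : measure_display) (Omega : measurableType d) (U : measurableType d').
Variables (P : probability Omega R) (xi : nat -> {mfun Omega >-> U}).
Variable arr : nat -> source J -> {mfun Omega >-> bool}.
Hypothesis noise : network_noise a P xi arr.
Hypotheses (p_gt0 : 0 < a / J%:R) (p_lt1 : a / J%:R < 1).

(** The deviations inside [L] have total probability at most [K * dd ^+ m] times that of [L]. For
    large [m] this factor is below 1, so a part of [L] of positive probability remains. *)
Lemma good_event (eps : R) (m0 : nat) : 0 < eps -> exists2 m : nat, (m0 <= m)%N &
  exists G : set Omega, [/\ measurable G, (0 < P G)%E &
    forall w, G w -> loaded arr m w /\ forall t i, ~ deviates a arr m eps t i w].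
Proof.
move=> eps0; have [dd /andP[d0 d1] dev] := bern_deviation (ltW p_gt0) (ltW p_lt1) eps0.
(* [K] sums [2 * dd ^+ t] over all times [t] and all sources. *)
pose K : R := 2 * #|{: source J}|%:R / (1 - dd).
have K0 : 0 <= K by rewrite !mulr_ge0 ?invr_ge0 ?ler0n //; lra.
have [m [Km m0m]] : exists m, K * dd ^+ m < 1 /\ (m0 <= m)%N.
  have /cvgrPdist_lt /(_ 1 ltr01) small : geometric K dd n @[n --> \oo] --> (0 : R).
    by apply: cvg_geometric; rewrite ger0_norm // ltW.
  have [m [Km m0m]] := filter_ex (filterI small (nbhs_infty_ge m0)).
  exists m; split => //; move: Km; rewrite sub0r normrN; exact: le_lt_trans (ler_norm _).
exists m => //.
pose L := loaded arr m; pose c := fine (P L).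
have mL : measurable L by exact: measurable_loaded.
have c0 : 0 < c.
  rewrite /c (prob_loaded noise) /=; apply: prodr_gt0 => k _.
  by rewrite /bern; case: ifP; rewrite ?subr_gt0.
pose Bt t := \big[setU/set0]_(i : source J) (L `&` deviates a arr m eps t i).
pose B := \bigcup_t Bt t.
have mBt t : measurable (Bt t).
  by apply: bigsetU_measurable => i _; exact: measurable_loaded_deviates.
have mB : measurable B by exact: bigcupT_measurable.
have PBt t : (P (Bt t) <= (c * (1 - dd) * K * dd ^+ m * dd ^+ t)%:E)%E.
  apply: (le_trans (measure_bigsetU_le _ _ _ _)) => [i|].
    exact: measurable_loaded_deviates.
  apply: (@le_trans _ _ (\sum_(i : source J) (c * (2 * dd ^+ m * dd ^+ t))%:E)%E).
    by apply: lee_sum => i _; exact: (prob_loaded_deviates noise).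
  rewrite sumEFin sumr_const lee_fin -[_ *+ _]mulr_natl /K.
  by rewrite le_eqVlt; apply/orP; left; apply/eqP; field; lra.
have PB : (P B <= (c * K * dd ^+ m)%:E)%E.
  apply: le_trans (generalized_Boole_inequality P mBt mB) _.
  apply: lime_le; first exact: is_cvg_nneseries.
  apply: nearW => n.
  apply: (@le_trans _ _ (\sum_(0 <= t < n) (c * (1 - dd) * K * dd ^+ m * dd ^+ t)%:E)%E).
    by apply: lee_sum => t _; exact: PBt.
  rewrite sumEFin lee_fin -mulr_sumr big_mkord.
  have -> : c * (1 - dd) * K * dd ^+ m * (\sum_(t < n) dd ^+ t) = c * K * dd ^+ m * (1 - dd ^+ n).
    by rewrite -[1 - dd ^+ n]opprB subrX1; ring.
  have dm : 0 <= c * K * dd ^+ m.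
    by apply: mulr_ge0; [apply: mulr_ge0 => //; exact: ltW|apply: exprn_ge0; exact: ltW].
  by rewrite ler_piMr // gerBl exprn_ge0 // ltW.
have PBL : (P B < P L)%E.
  rewrite -(fineK (fin_num_measure P _ mL)); apply: (le_lt_trans PB).
  by rewrite lte_fin -mulrA gtr_pMr.
exists (L `\` B); split.
- exact: measurableD.
- rewrite lt_neqAle measure_ge0 andbT eq_sym; apply/eqP => G0.
  move: PBL; rewrite ltNge => /negP; apply.
  have -> : P B = (P B + P (L `\` B))%E by rewrite G0 adde0.
  apply: (@le_trans _ _ (P (B `|` (L `\` B)))); last by apply: measureU2 => //; exact: measurableD.
  apply: le_measure; rewrite ?inE //; first by apply: measurableU => //; exact: measurableD.
  by move=> w Lw; have [Bw|nBw] := pselect (B w); [left|right].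
- move=> w [Lw nBw]; split => // t i dw; apply: nBw; exists t => //.
  by rewrite /Bt -bigcup_seq; exists i; rewrite //= mem_index_enum.
Qed.
End Event.

(** * Measurability of the return event *)

Section Measurability.
Variables (J : nat) (d d' : measure_display) (Omega : measurableType d) (U : measurableType d').
Variables (xi : nat -> {mfun Omega >-> U}) (arr : nat -> source J -> {mfun Omega >-> bool}).
Variable pol : qvec J -> U -> qvec J.
Hypothesis mpol : forall q s, measurable [set u | pol q u = s].

Lemma measurable_queue_process x t q : measurable [set w | queue_process pol xi arr x t w = q].
Proof.
elim: t q => [|t IH] q /=.
  by have [->|xq] := eqVneq x q; [rewrite (_ : [set _ | _] = setT)//; apply/seteqP|
    rewrite (_ : [set _ | _] = set0)//; apply/seteqP; split=> // w /= e; rewrite e eqxx in xq].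
(* The event is split over the countably many triples of previous state, chosen schedule and arrival
   vector. *)
pose F (k : qvec J * qvec J * {ffun source J -> bool}) : set Omega :=
  if step k.1.1 k.1.2 (fun i => k.2 i : nat) == q then
    [set w | queue_process pol xi arr x t w = k.1.1] `&` (xi t @^-1` [set u | pol k.1.1 u = k.1.2])
    `&` \bigcap_(i in [set: source J]) arr_at arr (t, i) (k.2 i)
  else set0.
have -> : [set w | step (queue_process pol xi arr x t w)
   (pol (queue_process pol xi arr x t w) (xi t w)) (fun i => arr t i w : nat) = q] = \bigcup_k F k.
  apply/seteqP; split=> w /=.
    move=> stepq; exists (queue_process pol xi arr x t w,
      pol (queue_process pol xi arr x t w) (xi t w), [ffun i => arr t i w]) => //.
    rewrite /F /= (_ : (fun i => _) = (fun i => arr t i w : nat)).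
      by rewrite stepq eqxx; split=> //= i _; rewrite /arr_at /= ffunE.
    by apply/funext => i; rewrite ffunE.
  move=> [[[q' s'] e] _]; rewrite /F /=; case: eqP => // <- [[/= -> ->] we].
  by congr step; apply/funext => i; congr nat_of_bool; exact: (we i).
apply: countable_bigcupT_measurable => [|k]; first exact: countableP.
rewrite /F; case: ifP => // _; apply: measurableI; first apply: measurableI => //.
  exact: measurable_funPTI.
apply: fin_bigcap_measurable => [|i _]; last exact: measurable_arr_at.
exact: finite_finset.
Qed.

Lemma measurable_return x :
  measurable [set w | exists2 t : nat, (0 < t)%N & queue_process pol xi arr x t w = x].
Proof.
rewrite (_ : [set _ | _] = \bigcup_t [set w | (0 < t)%N /\ queue_process pol xi arr x t w = x]).
  apply: bigcupT_measurable => t; case: t => [|t].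
    by rewrite (_ : [set _ | _] = set0) //; apply/seteqP; split=> // w [].
  rewrite (_ : [set _ | _] = [set w | queue_process pol xi arr x t.+1 w = x]).
    exact: measurable_queue_process.
  by apply/seteqP; split=> w //= [].
by apply/seteqP; split=> w /= [t]; [move=> ? ?|move=> _ []]; exists t.
Qed.
End Measurability.

Theorem theorem1 (R : realType) (J nu : nat) (a : R)
    (hJ : (0 < J)%N) (hnu : (0 < nu)%N) (ha : 0 < a)
    (h1 : a * (1 + nu%:R^-1) < 1)
    (h2 : (1 < nu < J)%N)
    (h3 : J%:R / (2 * J%:R - nu%:R) < a)
    (h4 : a < 1 - (J%:R + nu%:R) * (J%:R + nu%:R ^+ 2)
                  / (nu%:R * (J%:R ^+ 2 + J%:R + nu%:R ^+ 2))) :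
  @subcritical R J nu (qrow (traffic a)) /\
  forall (d d' : measure_display) (Omega : measurableType d)
    (U : measurableType d') (P : probability Omega R)
    (xi : nat -> {mfun Omega >-> U})
    (arr : nat -> source J -> {mfun Omega >-> bool})
    (pol : qvec J -> U -> qvec J),
    network_noise a P xi arr -> maxweight R nu pol ->
    transient P (queue_process pol xi arr).
Proof.
split; first exact: traffic_subcritical.
move=> d d' Omega U P xi arr pol noise mw x.
have [nu1 nuJ] := andP h2.
have v1 : 1 < nu%:R :> R by rewrite ltr1n.
have vJ : nu%:R < J%:R :> R by rewrite ltr_nat.
(* Integrality turns [nu < J] into the unit margin that the loading phase needs. *)
have vJ1 : nu%:R <= J%:R - 1 :> R by rewrite lerBrDr natr1 ler_nat.
have J2 : 2 < J%:R :> R by rewrite ltr_nat; exact: leq_trans nuJ.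
have J0 : 0 < J%:R :> R by lra.
have a1 := arrival_rate_lt1 v1 ha h1.
have npE : J%:R * (a / J%:R) = a by rewrite mulrCA divff ?mulr1 // gt_eqF.
have [eps eps0 never] := never_back erefl v1 vJ1 J2 ha a1 npE
  (drift_gap_cond v1 vJ ha h4) (grow_cond v1 vJ h3).
pose k : R := \sum_b ((x (b, None))%:R + \sum_j (x (b, Some j))%:R).
have k0 : 0 <= k.
  by apply: sumr_ge0 => b _; rewrite addr_ge0 // sumr_ge0.
have [m0 {}never] := never k k0.
have p1 : a / J%:R < 1 by rewrite ltr_pdivrMr //; lra.
have [m m0m [G [mG PG Gw]]] := good_event noise (divr_gt0 ha J0) p1 m0 eps0.
set ret := [set w | _].
have mret : measurable ret by apply: measurable_return => q s; exact: (mw q).1.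
(* On [G] the number of jobs exceeds its initial value [k] at all positive times, which excludes a
   return to [x]. *)
have retG : ret `<=` ~` G.
  move=> w [t t0 Xt] /Gw [wl wd].
  have := maxweight_path (q := fun u => queue_process pol xi arr x u w)
    (s := fun u => pol (queue_process pol xi arr x u w) (xi u w))
    (e := fun u i => arr u i w) hJ hnu
    (fun u => ((mw _).2 _).1) (fun u => ((mw _).2 _).2) (fun u => erefl).
  move=> path; have := never m _ _ _ _ _ m0m path erefl _ _ t t0.
  rewrite /total_jobs Xt ltxx => H; apply: notF; apply: H => [u um b j|b j u].
    by have := wl (u, (b, j)); rewrite /= mem_loading => /(_ um) ->.
  by rewrite leNgt; apply/negP; exact: (wd u (b, j)).
apply: le_lt_trans (_ : (P ret <= P (~` G))%E) _.
  by apply: le_measure => //; rewrite inE //; exact: measurableC.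
rewrite probability_setC // -(fineK (fin_num_measure P _ mG)) -EFinB lte_fin.
by rewrite ltrBlDr ltrDl -lte_fin fineK // fin_num_measure.
Qed.
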